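(* Let $\mathcal{J}$ be a homogeneous Hopf ideal of $\mathcal{L}$ with corresponding semigroup $S$. Then the spectrum of $(\mathcal{L}_{\mathcal{J}})_*$ is $S_0$, the set of all nonzero elements of $S$. That is, the nonzero multiplicative linear functionals on the commutative Banach algebra $(\mathcal{L}_{\mathcal{J}})_*$ are exactly the evaluations $\rho_s:\varphi\mapsto\varphi(\pi_{\mathcal{J}}(L_w))$ for $s\in S_0$ and $w\in[s]$, with distinct $s\in S_0$ giving distinct functionals.
   Context: Let $d$ be a fixed positive integer, $\mathbb{F}_d^*$ the unital free semigroup on $\{1,\dots,d\}$ with identity $\varnothing$, and $\mathbb{F}_d^{*0}$ the semigroup obtained by adjoining a zero $0$. Let $\ell^2(\mathbb{F}_d^* )$ have orthonormal basis $\{\xi_w\}$ and put $L_u\xi_w=\xi_{uw}$, with $L_0:=0$. $\mathcal{L}=\mathcal{L}_d$ is the unital weak-operator-closed (WOT-closed) algebra generated by $\{L_u\}$, with comultiplication $\Delta_{\mathcal{L}}:\mathcal{L}\to\mathcal{L}\overline\otimes\mathcal{L}$, the unital weak*-continuous completely contractive homomorphism with $\Delta_{\mathcal{L}}(L_w)=L_w\otimes L_w$. A Hopf ideal is a WOT-closed two-sided ideal $\mathcal{J}$ with $\Delta_{\mathcal{L}}(\mathcal{J})\subseteq\overline{\mathcal{J}\otimes\mathcal{L}+\mathcal{L}\otimes\mathcal{J}}^{w^*}$; it is homogeneous if generated by homogeneous polynomials in $L_1,\dots,L_d$. Put $\mathcal{N}_{\mathcal{J}}=(\mathcal{J}\xi_\varnothing)^\perp$,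 $\mathcal{L}_{\mathcal{J}}=P_{\mathcal{N}_{\mathcal{J}}}\mathcal{L}|_{\mathcal{N}_{\mathcal{J}}}\cong\mathcal{L}/\mathcal{J}$, $\pi_{\mathcal{J}}(A)=P_{\mathcal{N}_{\mathcal{J}}}A|_{\mathcal{N}_{\mathcal{J}}}$. The predual $(\mathcal{L}_{\mathcal{J}})_*$ (weak*-continuous functionals on $\mathcal{L}_{\mathcal{J}}$) is a commutative Banach algebra under $\varphi\star\psi=(\varphi\otimes\psi)\circ\Delta_{\mathcal{J}}$, where $\Delta_{\mathcal{J}}:\mathcal{L}_{\mathcal{J}}\to\mathcal{L}_{\mathcal{J}}\overline\otimes\mathcal{L}_{\mathcal{J}}$ is the comultiplication determined by $\Delta_{\mathcal{J}}(\pi_{\mathcal{J}}(L_w))=\pi_{\mathcal{J}}(L_w)\otimes\pi_{\mathcal{J}}(L_w)$ ($w\in\mathbb{F}_d^*$). The corresponding semigroup is $S=\mathbb{F}_d^{*0}/{\sim}$, where $u\sim v$ iff $L_u-L_v\in\mathcal{J}$; $S_0=S\setminus\{\dot0\}$ with $\dot0$ the image of $0$; $[s]\subset\mathbb{F}_d^{*0}$ is the equivalence class of words representing $s$ (note $\pi_{\mathcal{J}}(L_w)$ depends only on the class of $w$). The spectrum of a commutative Banach algebra is its set of nonzero multiplicative linear functionals. *)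

(* Defs.v *)
From HB Require Import structures.
From mathcomp Require Import all_boot all_order all_algebra complex finmap ring.
From mathcomp Require Import all_classical all_reals all_analysis.
From mathcomp Require summability.
Set Implicit Arguments.
Unset Strict Implicit.
Unset Printing Implicit Defensive.
Import Order.TTheory GRing.Theory Num.Theory numFieldNormedType.Exports.
Local Open Scope classical_set_scope.
Local Open Scope ring_scope.
Local Open Scope complex_scope.

(* |z|^2, with values in R rather than in R[i] *)
Definition abs2 (R : realType) (z : R[i]) : R :=
  complex.Re z ^+ 2 + complex.Im z ^+ 2.

Section SquaredNorm.
Variables (R : realType) (I : choiceType).
Implicit Types (x y : I -> R[i]) (a : R[i]).

Definition sqnorm x : \bar R := \esum_(i in [set: I]) (abs2 (x i))%:E.

Lemma abs2_ge0 (z : R[i]) : 0 <= abs2 z.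
Proof. by rewrite /abs2 addr_ge0 ?sqr_ge0. Qed.

Lemma abs2M (z w : R[i]) : abs2 (z * w) = abs2 z * abs2 w.
Proof. by rewrite /abs2; case: z => a b; case: w => c d /=; ring. Qed.

Lemma abs2D (z w : R[i]) : abs2 (z + w) <= 2 * abs2 z + 2 * abs2 w.
Proof.
rewrite /abs2; case: z => a b; case: w => c d /=.
rewrite -subr_ge0 [X in 0 <= X](_ : _ = (a - c) ^+ 2 + (b - d) ^+ 2).
  by rewrite addr_ge0 ?sqr_ge0.
by ring.
Qed.

Lemma esumZl (J : choiceType) (r : R) (f : J -> \bar R) :
  0 <= r -> (forall j, 0 <= f j)%E ->
  (\esum_(j in [set: J]) (r%:E * f j) = r%:E * \esum_(j in [set: J]) f j)%E.
Proof.
move=> r0 f0; rewrite /esum -ereal_supZl//; last first.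
  by apply/set0P; exists (\sum_(j \in set0) f j)%E; exists set0 => //; exact: fsets_set0.
congr ereal_sup; apply/seteqP; split => _ [X XJ <-].
  by exists (\sum_(j \in X) f j)%E; [exists X|rewrite ge0_mule_fsumr].
by case: XJ => Y YJ <-; exists Y => //; rewrite ge0_mule_fsumr.
Qed.

Lemma sqnorm_ge0 x : (0 <= sqnorm x)%E.
Proof. by apply: esum_ge0 => i _; rewrite lee_fin abs2_ge0. Qed.

Lemma sqnorm0 : sqnorm 0 = 0%E.
Proof. by apply: esum1 => i _; rewrite /abs2 /= expr0n addr0. Qed.

Lemma sqnormZ a x : sqnorm (a *: x) = ((abs2 a)%:E * sqnorm x)%E.
Proof.
rewrite /sqnorm -esumZl ?abs2_ge0//; last by move=> j; rewrite lee_fin abs2_ge0.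
by apply: eq_esum => i _; rewrite -EFinM -abs2M.
Qed.

Lemma sqnormD x y : (sqnorm (x + y)%R <= 2%:E * sqnorm x + 2%:E * sqnorm y)%E.
Proof.
rewrite /sqnorm -!esumZl// ?[X in (_ <= X)%E]/=.
- rewrite -esumD.
  + apply: le_esum => i _; rewrite -!EFinM -EFinD lee_fin; exact: abs2D.
  + by move=> i _; rewrite -EFinM lee_fin mulr_ge0 ?abs2_ge0.
  + by move=> i _; rewrite -EFinM lee_fin mulr_ge0 ?abs2_ge0.
- by move=> j; rewrite lee_fin abs2_ge0.
- by move=> j; rewrite lee_fin abs2_ge0.
Qed.

Definition sqsum : {pred I -> R[i]} := [pred x | (sqnorm x < +oo)%E].

Lemma sqsum_submod_closed : submod_closed sqsum.
Proof.
split; first by rewrite inE sqnorm0.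
move=> a x y; rewrite !inE => xf yf; apply: le_lt_trans (sqnormD _ _) _.
by rewrite sqnormZ lte_add_pinfty ?lte_mul_pinfty ?lee_fin ?mule_ge0 ?lee_fin
  ?abs2_ge0 ?sqnorm_ge0.
Qed.

HB.instance Definition _ :=
  GRing.isSubmodClosed.Build _ _ sqsum sqsum_submod_closed.

End SquaredNorm.

(* The Hilbert space l^2(I). *)
Record ell2 (R : realType) (I : choiceType) := Ell2 {
  ell2_fun :> I -> R[i];
  _ : ell2_fun \in @sqsum R I }.
Arguments Ell2 {R I} _ _.

HB.instance Definition _ (R : realType) (I : choiceType) :=
  [isSub for @ell2_fun R I].
HB.instance Definition _ (R : realType) (I : choiceType) :=
  [Choice of ell2 R I by <:].
HB.instance Definition _ (R : realType) (I : choiceType) :=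
  [SubChoice_isSubLmodule of ell2 R I by <:].

Section Ell2.
Variables (R : realType) (I : choiceType).
Implicit Types x y : ell2 R I.

(* <x, y>, linear in x; the sum is the limit over the finite subsets of I. *)
Definition inner x y : R[i]^o :=
  summability.sum (fun i => x i * (y i)^* : R[i]^o).

Lemma sqnorm_delta (i : I) : (fun j => (j == i)%:R) \in @sqsum R I.
Proof.
rewrite inE /sqnorm; set f := (X in esum _ X).
suff -> : esum [set: I] f = esum [set i] f.
  by rewrite esum_set1 ?ltry// lee_fin abs2_ge0.
rewrite [RHS]esum_mkcond; apply: eq_esum => j _; rewrite /f.
by rewrite in_set1; case: eqP => //= _; rewrite /abs2 /= expr0n addr0.
Qed.

(* The basis vector at i. *)
Definition xi (i : I) : ell2 R I := Ell2 _ (sqnorm_delta i).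

Definition bounded_linear (T : ell2 R I -> ell2 R I) : Prop :=
  linear T /\
  exists2 B : R, 0 <= B & forall x, (sqnorm (T x) <= B%:E * sqnorm x)%E.

Definition bounded_linear_pred : {pred ell2 R I -> ell2 R I} :=
  [pred T | `[< bounded_linear T >]].

Lemma bounded_linear_submod_closed : submod_closed bounded_linear_pred.
Proof.
split.
  apply/asboolP; split; first by move=> a x y /=; rewrite scaler0 addr0.
  by exists 0 => // x; rewrite mul0e -[X in sqnorm X]/(0 : I -> R[i]) sqnorm0.
move=> a S T /asboolP[Sl [B B0 SB]] /asboolP[Tl [D D0 TD]]; apply/asboolP; split.
  move=> b x y; pose U z : ell2 R I := a *: S z + T z.
  rewrite -[LHS]/(U (b *: x + y)) -[RHS]/(b *: U x + U y) /U Sl Tl.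
  by rewrite !scalerDr !scalerA (mulrC a b) addrACA.
exists (2 * (abs2 a * B) + 2 * D).
  by rewrite addr_ge0 ?mulr_ge0 ?abs2_ge0.
move=> x; apply: le_trans (sqnormD (a *: S x) (T x)) _.
rewrite sqnormZ (EFinD (2 * _)) ge0_muleDl ?lee_fin ?mulr_ge0 ?abs2_ge0//.
rewrite (EFinM 2 (abs2 a * B)) (EFinM (abs2 a) B) (EFinM 2 D) -!muleA.
have w (r : R) (u v : \bar R) : 0 <= r -> (u <= v -> r%:E * u <= r%:E * v)%E.
  by move=> r0; apply: lee_wpmul2l; rewrite lee_fin.
apply: leeD; apply: (w 2) => //.
by apply: w; [exact: abs2_ge0|exact: SB].
Qed.

HB.instance Definition _ := GRing.isSubmodClosed.Build _ _ bounded_linear_pred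
  bounded_linear_submod_closed.

End Ell2.

(* B(l^2(I)) *)
Record bop (R : realType) (I : choiceType) := Bop {
  bop_fun :> ell2 R I -> ell2 R I;
  _ : bop_fun \in @bounded_linear_pred R I }.

HB.instance Definition _ (R : realType) (I : choiceType) :=
  [isSub for @bop_fun R I].
HB.instance Definition _ (R : realType) (I : choiceType) :=
  [Choice of bop R I by <:].
HB.instance Definition _ (R : realType) (I : choiceType) :=
  [SubChoice_isSubLmodule of bop R I by <:].

Definition mk_bop (R : realType) (I : choiceType) (T : ell2 R I -> ell2 R I)
  (hT : bounded_linear T) : bop R I := Bop (asboolT hT).

Section BopRing.
Variables (R : realType) (I : choiceType).
Implicit Types A B C : bop R I.

Lemma bopP A : bounded_linear A.
Proof. by apply/asboolP; case: A. Qed.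

Lemma bop_ext A B : A =1 B -> A = B.
Proof. by move=> AB; apply/val_inj/funext. Qed.

Lemma bounded_linear_id : bounded_linear (@idfun (ell2 R I)).
Proof. by split=> //; exists 1 => // x; rewrite mul1e. Qed.

Lemma bounded_linear_comp (S T : ell2 R I -> ell2 R I) :
  bounded_linear S -> bounded_linear T -> bounded_linear (S \o T).
Proof.
move=> [Sl [B B0 SB]] [Tl [D D0 TD]]; split.
  by move=> a x y; rewrite /= Tl Sl.
exists (B * D); first exact: mulr_ge0.
move=> x; apply: le_trans (SB _) _.
by rewrite EFinM -muleA; apply: lee_wpmul2l; rewrite ?lee_fin.
Qed.

Definition bop1 : bop R I := mk_bop bounded_linear_id.
Definition bop_mul A B : bop R I := mk_bop (bounded_linear_comp (bopP A) (bopP B)).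

Lemma bop_linear A : linear A.
Proof. by case: (bopP A). Qed.

Lemma bop_additive A x y : A (x + y) = A x + A y.
Proof. by have := bop_linear A 1 x y; rewrite !scale1r. Qed.

Lemma bopZ A a x : A (a *: x) = a *: A x.
Proof.
have A0 : A 0 = 0.
  by have := bop_linear A (-1) 0 0; rewrite scaler0 addr0 scaleN1r addNr.
by have := bop_linear A a x 0; rewrite A0 !addr0.
Qed.

Fact bop_mulA : associative bop_mul.
Proof. by move=> A B C; exact: bop_ext. Qed.
Fact bop_mul1l : left_id bop1 bop_mul.
Proof. by move=> A; exact: bop_ext. Qed.
Fact bop_mul1r : right_id bop1 bop_mul.
Proof. by move=> A; exact: bop_ext. Qed.
Fact bop_mulDl : left_distributive bop_mul +%R.
Proof. by move=> A B C; exact: bop_ext. Qed.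
Fact bop_mulDr : right_distributive bop_mul +%R.
Proof. by move=> A B C; apply: bop_ext => x; exact: bop_additive. Qed.

HB.instance Definition _ := GRing.Zmodule_isPzRing.Build (bop R I)
  bop_mulA bop_mul1l bop_mul1r bop_mulDl bop_mulDr.

End BopRing.

Section TensorProduct.
Variables (R : realType) (I J : choiceType).

Lemma sqnorm_rows (z : I * J -> R[i]) :
  (\esum_(i in [set: I]) sqnorm (fun j => z (i, j)) = sqnorm z)%E.
Proof.
rewrite /sqnorm esum_esum; last by move=> i j _ _; rewrite lee_fin abs2_ge0.
rewrite [X in esum X _](_ : _ = [set: I * J]); last by apply/seteqP; split.
by apply: eq_esum => -[].
Qed.

Lemma sqnorm_cols (z : I * J -> R[i]) :
  (\esum_(j in [set: J]) sqnorm (fun i => z (i, j)) = sqnorm z)%E.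
Proof.
rewrite {1}/sqnorm esum_esum; last by move=> i j _ _; rewrite lee_fin abs2_ge0.
rewrite [X in esum X _](_ : _ = [set: J * I]); last by apply/seteqP; split.
rewrite /sqnorm (@reindex_esum _ _ _ [set: J * I] [set: I * J] (fun p => (p.2, p.1)))//.
split=> //; first by move=> [? ?] [? ?] _ _ [-> ->].
by move=> [i j] _; exists (j, i).
Qed.

Lemma esum_ge1 (K : choiceType) (f : K -> \bar R) k :
  (forall l, 0 <= f l)%E -> (f k <= \esum_(l in [set: K]) f l)%E.
Proof.
move=> f0; apply: esum_ge; exists [set k]; first by split=> //; exact: finite_set1.
by rewrite fsbig_set1.
Qed.

Lemma row_subproof (z : ell2 R (I * J)%type) (i : I) :
  (fun j => z (i, j)) \in @sqsum R J.
Proof.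
rewrite inE; apply: le_lt_trans (_ : (sqnorm z < +oo)%E); last exact: (valP z).
rewrite -sqnorm_rows; apply: (@esum_ge1 I (fun i => sqnorm (fun j => z (i, j)))).
by move=> l; exact: sqnorm_ge0.
Qed.
Definition ell2_row z i : ell2 R J := Ell2 _ (row_subproof z i).

Lemma col_subproof (z : ell2 R (I * J)%type) (j : J) :
  (fun i => z (i, j)) \in @sqsum R I.
Proof.
rewrite inE; apply: le_lt_trans (_ : (sqnorm z < +oo)%E); last exact: (valP z).
rewrite -sqnorm_cols; apply: (@esum_ge1 J (fun j => sqnorm (fun i => z (i, j)))).
by move=> l; exact: sqnorm_ge0.
Qed.
Definition ell2_col z j : ell2 R I := Ell2 _ (col_subproof z j).

Lemma sqnorm_tensr (B : bop R J) (D : R) (z : ell2 R (I * J)%type) : 0 <= D ->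
  (forall y, sqnorm (B y) <= D%:E * sqnorm y)%E ->
  (sqnorm (fun p => B (ell2_row z p.1) p.2) <= D%:E * sqnorm z)%E.
Proof.
move=> D0 BD; rewrite -[leLHS]sqnorm_rows -[sqnorm z]sqnorm_rows -esumZl//.
  by apply: le_esum => i _; exact: (BD (ell2_row z i)).
by move=> i; exact: sqnorm_ge0.
Qed.

Lemma sqnorm_tensl (A : bop R I) (D : R) (z : ell2 R (I * J)%type) : 0 <= D ->
  (forall x, sqnorm (A x) <= D%:E * sqnorm x)%E ->
  (sqnorm (fun p => A (ell2_col z p.2) p.1) <= D%:E * sqnorm z)%E.
Proof.
move=> D0 AD; rewrite -[leLHS]sqnorm_cols -[sqnorm z]sqnorm_cols -esumZl//.
  by apply: le_esum => i _; exact: (AD (ell2_col z i)).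
by move=> i; exact: sqnorm_ge0.
Qed.

Lemma tensr_subproof (B : bop R J) (z : ell2 R (I * J)%type) :
  (fun p => B (ell2_row z p.1) p.2) \in @sqsum R (I * J)%type.
Proof.
rewrite inE; have [_ [D D0 BD]] := bopP B.
apply: le_lt_trans (sqnorm_tensr _ D0 BD) _.
by apply: lte_mul_pinfty; [rewrite lee_fin|by []|exact: (valP z)].
Qed.

Lemma tensl_subproof (A : bop R I) (z : ell2 R (I * J)%type) :
  (fun p => A (ell2_col z p.2) p.1) \in @sqsum R (I * J)%type.
Proof.
rewrite inE; have [_ [D D0 AD]] := bopP A.
apply: le_lt_trans (sqnorm_tensl _ D0 AD) _.
by apply: lte_mul_pinfty; [rewrite lee_fin|by []|exact: (valP z)].
Qed.

Definition tensr_fun B z : ell2 R (I * J)%type := Ell2 _ (tensr_subproof B z).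
Definition tensl_fun A z : ell2 R (I * J)%type := Ell2 _ (tensl_subproof A z).

Lemma tensr_bounded B : bounded_linear (tensr_fun B).
Proof.
split; last first.
  by have [_ [D D0 BD]] := bopP B; exists D => // z; exact: sqnorm_tensr.
move=> a y z; apply/val_inj/funext => -[i j] /=.
have -> : ell2_row (a *: y + z) i = a *: ell2_row y i + ell2_row z i.
  by apply/val_inj/funext.
by rewrite bop_linear.
Qed.

Lemma tensl_bounded A : bounded_linear (tensl_fun A).
Proof.
split; last first.
  by have [_ [D D0 AD]] := bopP A; exists D => // z; exact: sqnorm_tensl.
move=> a y z; apply/val_inj/funext => -[i j] /=.
have -> : ell2_col (a *: y + z) j = a *: ell2_col y j + ell2_col z j.
  by apply/val_inj/funext.
by rewrite bop_linear.
Qed.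

(* A (x) B on l^2(I * J) = l^2(I) (x) l^2(J), built as (A (x) 1)(1 (x) B); it is
   characterized by tensopE. *)
Definition tensop (A : bop R I) (B : bop R J) : bop R (I * J)%type :=
  mk_bop (tensl_bounded A) * mk_bop (tensr_bounded B).

Lemma tensv_subproof (x : ell2 R I) (y : ell2 R J) :
  (fun p => x p.1 * y p.2) \in @sqsum R (I * J)%type.
Proof.
rewrite inE -sqnorm_rows.
rewrite (eq_esum (b := fun i => ((sqnorm y) * (abs2 (x i))%:E)%E)); last first.
  by move=> i _; rewrite muleC -sqnormZ.
have yfin : (sqnorm y < +oo)%E by exact: (valP y).
have y0 := sqnorm_ge0 y.
have -> : sqnorm y = (fine (sqnorm y))%:E by rewrite fineK// ge0_fin_numE.
rewrite esumZl ?fine_ge0//; last by move=> i; rewrite lee_fin abs2_ge0.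
by apply: lte_mul_pinfty; [rewrite lee_fin fine_ge0|by []|exact: (valP x)].
Qed.

Definition tensv x y : ell2 R (I * J)%type := Ell2 _ (tensv_subproof x y).

Lemma tensopE A B x y : tensop A B (tensv x y) = tensv (A x) (B y).
Proof.
apply/val_inj/funext => -[i j] /=.
have -> : ell2_col (tensr_fun B (tensv x y)) j = (B y j) *: x.
  apply/val_inj/funext => k /=.
  have -> : ell2_row (tensv x y) k = x k *: y by exact/val_inj/funext.
  by rewrite bopZ; exact: mulrC.
by rewrite bopZ; exact: mulrC.
Qed.

End TensorProduct.

Section OperatorTopologies.
Variables (R : realType) (I : choiceType).

Definition wot_map (T : bop R I) :
    {ptws (ell2 R I * ell2 R I) -> R[i]^o} :=
  fun p => inner (T p.1) p.2.

(* weak operator topology *)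
Definition wot : topologicalType := initial_topology wot_map.

Definition sqsummable_seq : set (nat -> ell2 R I) :=
  [set x | (\esum_(n in [set: nat]) sqnorm (x n) < +oo)%E].

Definition wstar_map (T : bop R I) :
    {ptws (sqsummable_seq * sqsummable_seq) -> R[i]^o} :=
  fun p => summability.sum (fun n : nat => inner (T (\val p.1 n)) (\val p.2 n)).

(* weak* (i.e. sigma-weak) topology of B(l^2(I)), as the dual of the trace class
   operators *)
Definition wstar : topologicalType := initial_topology wstar_map.

Definition wstar_on (M : set (bop R I)) : topologicalType :=
  set_type (M : set wstar).

End OperatorTopologies.

Section LinearSets.
Variables (R : realType) (V : lmodType R[i]).

Definition subspace (M : set V) : Prop :=
  M 0 /\ forall (a : R[i]) (x y : V), M x -> M y -> M (a *: x + y).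

Definition lspan (G : set V) : set V := smallest subspace G.

Definition linear_on (W : lmodType R[i]) (M : set V) (f : M -> W) : Prop :=
  forall (a : R[i]) (x y z : M),
    \val z = a *: \val x + \val y -> f z = a *: f x + f y.

End LinearSets.

Section DualAlgebras.
Variables (R : realType) (I J : choiceType).

Definition alg_tensor (M : set (bop R I)) (N : set (bop R J)) :
    set (bop R (I * J)%type) :=
  lspan [set tensop A B | A in M & B in N].

(* normal (weak*-closed) spatial tensor product *)
Definition wtensor (M : set (bop R I)) (N : set (bop R J)) :
    set (bop R (I * J)%type) :=
  closure (alg_tensor M N : set (wstar R (I * J)%type)).

Lemma tensop_wtensor (M : set (bop R I)) (N : set (bop R J)) (A : M) (B : N) :
  wtensor M N (tensop (\val A) (\val B)).
Proof.
apply: subset_closure; apply: sub_gen_smallest.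
by exists (\val A); [exact: set_valP|exists (\val B) => //; exact: set_valP].
Qed.

Definition tensor_elt (M : set (bop R I)) (N : set (bop R J)) (A : M) (B : N) :
  wtensor M N := SigSub (mem_set (@tensop_wtensor M N A B)).

End DualAlgebras.

Section Comultiplication.
Variables (R : realType) (I : choiceType) (M : set (bop R I)).

(* Delta is a weak*-continuous homomorphism M -> M (x) M that sends the elements
   e w to e w (x) e w.  It is unital as soon as the unit of M is one of the e w. *)
Definition comultiplication (W : Type) (e : W -> M) (Delta : M -> wtensor M M) :
    Prop :=
  [/\ continuous (Delta : wstar_on M -> wstar_on (wtensor M M)),
      linear_on (fun A => \val (Delta A)),
      forall A B C : M, \val C = \val A * \val B ->
        \val (Delta C) = \val (Delta A) * \val (Delta B) &
      forall w, Delta (e w) = tensor_elt (e w) (e w)].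

(* For all n, the map induced by Delta on n x n matrices does not increase the
   operator norm; K bounds the square of the norm. *)
Definition completely_contractive (Delta : M -> wtensor M M) : Prop :=
  forall (n : nat) (A : 'I_n -> 'I_n -> M) (K : R), 0 <= K ->
    (forall x : 'I_n -> ell2 R I,
       (\sum_(i < n) sqnorm (\sum_(j < n) \val (A i j) (x j))%R
          <= K%:E * \sum_(j < n) sqnorm (x j))%E) ->
    forall y : 'I_n -> ell2 R (I * I)%type,
       (\sum_(i < n) sqnorm (\sum_(j < n) \val (Delta (A i j)) (y j))%R
          <= K%:E * \sum_(j < n) sqnorm (y j))%E.

End Comultiplication.

(* the weak*-continuous linear functionals on M *)
Definition predual (R : realType) (I : choiceType) (M : set (bop R I)) :
    set (M -> R[i]^o) :=
  [set phi | linear_on phi /\ continuous (phi : wstar_on M -> R[i]^o)].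
Arguments predual {R I} M _.

Section Spectrum.
Variables (R : realType) (I : choiceType).
Variable M : set (bop R I).
Implicit Types phi psi chi : predual M.

(* theta = phi (x) psi; a weak*-continuous theta is determined by these values. *)
Definition is_tensor_functional phi psi (theta : predual (wtensor M M)) : Prop :=
  forall A B : M, \val theta (tensor_elt A B) = \val phi A * \val psi B.

(* chi = (phi (x) psi) o Delta *)
Definition is_convolution (Delta : M -> wtensor M M) phi psi chi : Prop :=
  exists2 theta, is_tensor_functional phi psi theta &
    forall A, \val chi A = \val theta (Delta A).

Definition spectrum (Delta : M -> wtensor M M) : set (predual M -> R[i]^o) :=
  [set rho | [/\ linear_on rho,
     forall phi psi chi, is_convolution Delta phi psi chi ->
       rho chi = rho phi * rho psi &
     exists phi, rho phi != 0]].

Definition evaluation (A : M) : predual M -> R[i]^o := fun phi => \val phi A.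

End Spectrum.

Section LeftCreation.
Variables (R : realType) (d : nat).

(* the free monoid on d letters: concatenation ++, unit [::] *)
Definition word : choiceType := seq 'I_d.
(* the free monoid with a zero None adjoined *)
Definition word0 : choiceType := option word.

Definition shift_fun (u : word) (x : word -> R[i]) : word -> R[i] :=
  fun v => if prefix u v then x (drop (size u) v) else 0.

Lemma shift_cat u x w : shift_fun u x (u ++ w) = x w.
Proof. by rewrite /shift_fun prefix_prefix drop_size_cat. Qed.

Lemma sqnorm_shift (u : word) x : sqnorm (shift_fun u x) = sqnorm x.
Proof.
rewrite /sqnorm; transitivity
  (\esum_(v in [set u ++ w | w in [set: word]]) (abs2 (shift_fun u x v))%:E)%E.
  rewrite [RHS]esum_mkcond; apply: eq_esum => v _; case: ifPn => // /negP vP.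
  rewrite /shift_fun; case: prefixP => [[w vE]|_]; last by rewrite /abs2 /= expr0n addr0.
  by case: vP; apply/mem_set; exists w.
rewrite esum_image; first by apply: eq_esum => w _; rewrite shift_cat.
move=> v w _ _ vw; apply/eqP; have /eqP := vw; rewrite eqseq_cat//.
by case/andP.
Qed.

Lemma shift_subproof u (x : ell2 R word) : shift_fun u x \in @sqsum R word.
Proof. by rewrite inE sqnorm_shift; exact: (valP x). Qed.

Lemma shift_bounded u :
  bounded_linear (fun x : ell2 R word => Ell2 _ (shift_subproof u x)).
Proof.
split; last by exists 1 => // x; rewrite mul1e /= sqnorm_shift.
move=> a x y; apply/val_inj/funext => v /=.
rewrite -[RHS]/(a * shift_fun u x v + shift_fun u y v) /shift_fun.
by case: ifP => // _; rewrite mulr0 addr0.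
Qed.

Definition Lop (u : word) : bop R word := mk_bop (shift_bounded u).

Lemma Lop_xi u w : Lop u (xi R w) = xi R (u ++ w).
Proof.
apply/val_inj/funext => v; rewrite /= /shift_fun.
case: prefixP => [[t ->]|nv]; first by rewrite drop_size_cat// eqseq_cat// eqxx.
by case: eqP => // vE; case: nv; exists w.
Qed.

Lemma Lop_nil : Lop [::] = 1.
Proof.
by apply: bop_ext => x; apply/val_inj/funext => v; rewrite /= /shift_fun prefix0s drop0.
Qed.

Definition Lop0 (u : word0) : bop R word := if u is Some w then Lop w else 0.

Definition unital_wot_subalgebra (M : set (bop R word)) : Prop :=
  [/\ subspace M, M 1, forall A B, M A -> M B -> M (A * B) &
      closed (M : set (wot R word))].

(* the noncommutative analytic Toeplitz algebra *)
Definition Lalg : set (bop R word) :=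
  smallest unital_wot_subalgebra [set Lop u | u in [set: word]].

Lemma Lop_Lalg u : Lalg (Lop u).
Proof. by apply: sub_gen_smallest; exists u. Qed.

Definition Lelt (u : word) : Lalg := SigSub (mem_set (Lop_Lalg u)).

Definition wot_ideal (J : set (bop R word)) : Prop :=
  [/\ J `<=` Lalg, subspace J,
      forall A B, Lalg A -> J B -> J (A * B) /\ J (B * A) &
      closed (J : set (wot R word))].

Definition hopf_ideal (Delta : Lalg -> wtensor Lalg Lalg) (J : set (bop R word)) :
    Prop :=
  wot_ideal J /\
  forall A : Lalg, J (\val A) ->
    closure ([set S + T | S in alg_tensor J Lalg & T in alg_tensor Lalg J]
             : set (wstar R (word * word)%type)) (\val (Delta A)).

(* p(L_1, ..., L_d) for a noncommutative homogeneous polynomial p *)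
Definition homogeneous_poly (A : bop R word) : Prop :=
  exists n : nat, lspan [set Lop w | w in [set w | size w = n]] A.

Definition homogeneous_ideal (J : set (bop R word)) : Prop :=
  exists2 G : set (bop R word), G `<=` homogeneous_poly &
    J = smallest wot_ideal G.

Section Quotient.
Variable J : set (bop R word).

(* the orthogonal complement of J xi_[::] *)
Definition Nperp : set (ell2 R word) :=
  [set x | forall A, J A -> inner (A (xi R [::])) x = 0].

Definition wequiv (u v : word0) : Prop := J (Lop0 u - Lop0 v).
Definition wclass (u : word0) : set word0 := [set v | wequiv u v].
Definition classes : set (set word0) := range wclass.
Definition nonzero_classes : set (set word0) := classes `\ wclass None.

End Quotient.

Definition is_orth_proj (N : set (ell2 R word)) (P : bop R word) : Prop :=
  forall x, N (P x) /\ forall y, N y -> inner (x - P x) y = 0.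

(* The compression P A|N of A to the range N of the projection P, where B(N) is
   identified with the corner P B(H) P of B(H).  This identification is isometric
   and a weak*-homeomorphism, and sends N (x) N to the range of P (x) P. *)
Definition compress (P A : bop R word) : bop R word := P * A * P.

Definition Lquot (P : bop R word) : set (bop R word) := compress P @` Lalg.

Lemma compress_Lquot P u : Lquot P (compress P (Lop u)).
Proof. by exists (Lop u) => //; exact: Lop_Lalg. Qed.

Definition piL P (u : word) : Lquot P := SigSub (mem_set (compress_Lquot P u)).

End LeftCreation.
Arguments Lalg : clear implicits.
Arguments Lelt : clear implicits.

(* Main.v *)
Require Import Defs.
From mathcomp Require Import all_boot all_order all_algebra complex finmap ring lra zify.
From mathcomp Require Import all_classical all_reals all_analysis.
From mathcomp Require summability.

(** Write L for the free semigroup algebra, g_w for the compression P L_w P, N for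
    the range of P and M for the algebra of the compressions of elements of L. A
    weak-star continuous functional on M is a vector functional omega X Y,
    A |-> <(A (x) 1) X, Y>, with X and Y in the Hilbert sum of countably many
    copies of N ([predual_supported]). It is determined by its values at the g_w
    ([predual_ext]): for A in L, the de la Vallee Poussin means of A are
    polynomials in the L_w, they are bounded by a multiple of the norm of A and
    have the same coefficients as A in low degree, so that polynomials are
    weak-star dense ([omega_density]).
    Hence chi is the convolution of phi and psi if and only if
    chi(g_w) = phi(g_w) psi(g_w) for all words w ([is_convolutionP]): the predual
    is an algebra of functions of w under pointwise multiplication, and the
    evaluations at the nonzero g_w are characters.

    Conversely let rho be a character. The indicator function delta of the class
    of w belongs to the predual when g_w <> 0 ([class_functional]), and the
    convolution of phi and delta is phi(g_w) delta. If rho(delta) <> 0 for one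
    class, cancelling rho(delta) shows that rho is the evaluation at g_w
    ([character_evaluation]). Otherwise rho vanishes on every functional that is
    zero at all long words, which allows one to remove the low-degree part of Y
    from omega X Y without changing the value of rho ([character_high]). If
    rho(phi) <> 0, one may thus assume that rho(phi) = 1 and that X and Y are
    small. The sum psi of the convolution powers of phi then converges and
    satisfies psi = phi + phi * psi ([quasi_inverse]), and applying rho gives
    rho(psi) = 1 + rho(psi), a contradiction ([character_zero]).

    The convolution powers are controlled by an explicit model. A pair of words is
    (p a, p b) for a unique longest common prefix p, and L_w (x) L_w acts on p
    alone. Splitting X (x) X' along the pairs (a, b) turns the convolution of
    omega X Y and omega X' Y' into omega (star X X') (star Y Y'), where star
    multiplies norms ([omega_star], [sqnorm_star]). It maps vectors over N to
    vectors over N because N consists of the square summable functions on words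
    that are constant on the classes and zero on the class of 0
    ([Nperp_class_function], [class_function_Nperp]).

    This description of N is the place where the comultiplication and homogeneity
    enter. Since the comultiplication sends g_w to g_w (x) g_w, a linear relation
    between the g_w remains a relation after its coefficients are multiplied by a
    matrix coefficient of g_w; interpolation with products of matrix coefficients
    isolates one class ([relation_interpolate]), so distinct nonzero g_w are
    linearly independent. Homogeneity makes J stable under truncation of Fourier
    series ([ideal_trunc]). This reduces the membership of a vector in N to
    finitely many words, shows by linear algebra in finite dimension that
    g_u = g_v if and only if L_u - L_v lies in J ([class_eqP]), and forces the
    words of a nonzero class to have the same length ([class_size]). *)

Set Implicit Arguments.
Unset Strict Implicit.
Unset Printing Implicit Defensive.
Import Order.TTheory GRing.Theory Num.Theory numFieldNormedType.Exports.
Import Normc.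
Local Open Scope classical_set_scope.
Local Open Scope ring_scope.
Local Open Scope complex_scope.

(** * Unconditional sums of complex families *)

#[local] Existing Instance summability.totally_filter.

Section UnconditionalSums.
Variable R : realType.

Definition has_sum (I : choiceType) (f : I -> R[i]) (s : R[i]) : Prop :=
  (fun F : {fset I} => \sum_(i <- F) f i : R[i]^o) @ summability.totally
    --> (s : R[i]^o).

Definition csum (I : choiceType) (f : I -> R[i]) : R[i] :=
  summability.sum (f : I -> R[i]^o).

Definition abs_summable (I : choiceType) (f : I -> R[i]) : Prop :=
  (\esum_(i in [set: I]) (normc (f i))%:E < +oo)%E.

Lemma normcE (z : R[i]) : `|z| = (normc z)%:C.
Proof. by case: z. Qed.

Lemma normc_ge0 (z : R[i]) : 0 <= normc z.
Proof. by case: z => a b; exact: sqrtr_ge0. Qed.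

Lemma abs2E (z : R[i]) : abs2 z = normc z ^+ 2.
Proof. by case: z => a b /=; rewrite sqr_sqrtr// addr_ge0 ?sqr_ge0. Qed.

Lemma abs20 : abs2 (0 : R[i]) = 0.
Proof. by rewrite /abs2 /= expr0n addr0. Qed.

Lemma abs2_real (r : R) : abs2 r%:C = r ^+ 2.
Proof. by rewrite /abs2 /= expr0n addr0. Qed.

(** Cauchy-Schwarz for n terms. *)
Lemma abs2_sum n (z : nat -> R[i]) :
  abs2 (\sum_(j < n) z j) <= n%:R * \sum_(j < n) abs2 (z j).
Proof.
elim: n => [|n IHn]; first by rewrite !big_ord0 abs20 mul0r.
rewrite !big_ord_recr /=; move: IHn.
set s := \sum_(j < n) z j; set S := \sum_(j < n) abs2 (z j).
have [->|n0] := posnP n.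
  rewrite mul0r => s0; have /eqP : abs2 s = 0 by apply/eqP; rewrite eq_le s0 abs2_ge0.
  have S0 : 0 <= S by apply: sumr_ge0 => j _; exact: abs2_ge0.
  rewrite paddr_eq0 ?sqr_ge0// !sqrf_eq0 => /andP[/eqP a0 /eqP b0].
  rewrite (complexE s) a0 b0 mulr0 !add0r mul1r.
  by rewrite lerDr.
have nR : 0 < n%:R :> R by rewrite ltr0n.
rewrite /abs2; case: s (z n) => a b [c e] /= IHn; rewrite -natr1.
rewrite -(ler_pM2l nR) -subr_ge0.
have -> : n%:R * ((n%:R + 1) * (S + (c ^+ 2 + e ^+ 2))) -
   n%:R * ((a + c) ^+ 2 + (b + e) ^+ 2) =
   (n%:R + 1) * (n%:R * S - (a ^+ 2 + b ^+ 2)) + ((a - n%:R * c) ^+ 2 + (b - n%:R * e) ^+ 2).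
  by ring.
apply: addr_ge0; last by rewrite addr_ge0 ?sqr_ge0.
by apply: mulr_ge0; [rewrite addr_ge0|rewrite subr_ge0].
Qed.

(** The eps form with a real eps; positive elements of R[i] are real. *)
Lemma has_sumP (I : choiceType) (f : I -> R[i]) (s : R[i]) :
  has_sum f s <-> forall e : R, 0 < e -> exists A : {fset I},
    forall B : {fset I}, (A `<=` B)%fset -> normc (s - \sum_(i <- B) f i) < e.
Proof.
split.
  move=> /(@cvgrPdist_lt _ R[i]^o) fs e e0.
  have [|A _ AP] := fs e%:C; first by rewrite ltcR.
  by exists A => B /AP; rewrite /= normcE ltcR.
move=> fs; apply/(@cvgrPdist_lt _ R[i]^o) => e e0.
have eR : e = (complex.Re e)%:C by rewrite RRe_real// gtr0_real.
rewrite eR ltcR in e0; have [A AP] := fs _ e0.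
by exists A => // B AB /=; rewrite normcE eR ltcR; exact: AP.
Qed.

Lemma csumE (I : choiceType) (f : I -> R[i]) (s : R[i]) :
  has_sum f s -> csum f = s.
Proof.
move=> fs; apply: (@cvg_lim R[i]^o); first exact: norm_hausdorff.
rewrite [X in X @ _](_ : _ = (fun F : {fset I} => \sum_(i <- F) f i)) //.
by apply/funext => F; rewrite /summability.partial_sum big_seq_fsetE.
Qed.

Section Ops.
Variable I : choiceType.
Implicit Types f g : I -> R[i].

Lemma eq_has_sum f g s : f =1 g -> has_sum f s -> has_sum g s.
Proof. by move=> /funext ->. Qed.

Lemma has_sumD f g s t : has_sum f s -> has_sum g t ->
  has_sum (fun i => f i + g i) (s + t).
Proof.
move=> fs gt; rewrite /has_sum.
under eq_fun do rewrite big_split /=.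
exact: (@cvgD _ R[i]^o _ _ _ _ _ s t fs gt).
Qed.

Lemma has_sumZ a f s : has_sum f s -> has_sum (fun i => a * f i) (a * s).
Proof.
move=> fs; rewrite /has_sum.
under eq_fun do rewrite -big_distrr /=.
exact: (@cvgMl_tmp R[i]).
Qed.
Arguments has_sumZ a {f s}.

Lemma has_sum_conj f s : has_sum f s -> has_sum (fun i => (f i)^*) s^*.
Proof.
move=> /has_sumP fs; apply/has_sumP => e /fs[A AP].
exists A => B /AP; rewrite -rmorph_sum -rmorphB /=.
by case: (s - _) => a b /=; rewrite sqrrN.
Qed.

Lemma has_sum_bound f s (M : R) :
  has_sum f s -> (forall A : {fset I}, \sum_(i <- A) normc (f i) <= M) ->
  normc s <= M.
Proof.
move=> /has_sumP fs fM; apply/ler_addgt0Pr => e /fs[A /(_ A (fsubset_refl _))].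
move=> sA; rewrite -(subrK (\sum_(i <- A) f i) s) addrC.
apply: le_trans (le_normcD _ _) _; apply: lerD; last exact: ltW.
apply: le_trans (fM A); rewrite -lecR -normcE rmorph_sum /=.
by under [X in _ <= X]eq_bigr do rewrite -normcE; exact: ler_norm_sum.
Qed.

Lemma fset_le_esum (g : I -> R) (A : {fset I}) : (forall i, 0 <= g i) ->
  ((\sum_(i <- A) g i)%:E <= \esum_(i in [set: I]) (g i)%:E)%E.
Proof.
move=> g0; apply: esum_ge; exists [set` A] => //; rewrite fsbig_finite//=.
by rewrite set_fsetK sumEFin.
Qed.

Lemma nneg_has_sum (g : I -> R) : (forall i, 0 <= g i) ->
  (\esum_(i in [set: I]) (g i)%:E < +oo)%E -> exists s, has_sum (fun i => (g i)%:C) s.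
Proof.
move=> g0 goo; set S := esum _ _ in goo.
have S0 : (0 <= S)%E by apply: esum_ge0 => i _; rewrite lee_fin.
have Sf : S \is a fin_num by rewrite ge0_fin_numE.
exists (fine S)%:C; apply/has_sumP => e e0.
have [_ [X [Xf _] <-] XS] := @ub_ereal_sup_adherent _ _ _ e0 Sf.
exists (fset_set X) => B XB.
rewrite -rmorph_sum -rmorphB /= expr0n/= addr0 sqrtr_sqr.
have BS := fset_le_esum B g0; rewrite -/S -(fineK Sf) lee_fin in BS.
rewrite ger0_norm ?subr_ge0// ltrBlDr addrC -ltrBlDr.
apply: lt_le_trans (_ : \sum_(i <- fset_set X) g i <= _).
  rewrite -lte_fin EFinB fineK// -sumEFin.
  by move: XS; rewrite fsbig_finite.
rewrite -lee_fin -!sumEFin.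
rewrite (big_fsetID _ (mem (fset_set X)) B) /=.
have -> : [fset x in B | x \in fset_set X]%fset = fset_set X.
  apply/fsetP => x; rewrite !inE /=; apply/andP/idP => [[]//|xX]; split => //.
  exact: (fsubsetP XB).
by rewrite leeDl// sume_ge0// => i _; rewrite lee_fin.
Qed.

(** Re and Im are split into positive and negative parts, each of which is a
    nonnegative family with a finite supremum of partial sums. *)
Lemma abs_summable_has_sum f : abs_summable f -> has_sum f (csum f).
Proof.
move=> fa.
have part (h : R[i] -> R) : (forall z, 0 <= h z <= normc z) ->
    exists s, has_sum (fun i => (h (f i))%:C) s.
  move=> hP; apply: nneg_has_sum => [i|]; first by case/andP: (hP (f i)).
  apply: le_lt_trans fa; apply: le_esum => i _; rewrite lee_fin.
  by case/andP: (hP (f i)).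
have Re_le (z : R[i]) : `|complex.Re z| <= normc z.
  case: z => a b /=; rewrite -sqrtr_sqr ler_wsqrtr// lerDl sqr_ge0 //.
have Im_le (z : R[i]) : `|complex.Im z| <= normc z.
  case: z => a b /=; rewrite -sqrtr_sqr ler_wsqrtr// lerDr sqr_ge0 //.
have pos (h : R[i] -> R) : (forall z, `|h z| <= normc z) ->
    exists s, has_sum (fun i => (h (f i))%:C) s.
  move=> hP.
  have [|s sP] := part (fun z => Num.max (h z) 0).
    move=> z; rewrite le_max lexx orbT/= ge_max normc_ge0 andbT.
    exact: le_trans (ler_norm _) (hP z).
  have [|t tP] := part (fun z => Num.max (- h z) 0).
    move=> z; rewrite le_max lexx orbT/= ge_max normc_ge0 andbT.
    by apply: le_trans (ler_norm _) _; rewrite normrN.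
  exists (s + (-1) * t); apply: eq_has_sum (has_sumD sP (has_sumZ (-1) tP)) => i /=.
  rewrite mulN1r -rmorphB /=; congr (_%:C).
  by rewrite /Num.max; case: ifP; case: ifP; lra.
have [s sP] := pos _ Re_le; have [t tP] := pos _ Im_le.
have fs : has_sum f (s + 'i%C * t).
  by apply: eq_has_sum (has_sumD sP (has_sumZ 'i%C tP)) => i /=; rewrite -complexE.
by rewrite (csumE fs).
Qed.

End Ops.

Lemma csum_bound (I : choiceType) (f : I -> R[i]) (M : R) :
  (\esum_(i in [set: I]) (normc (f i))%:E <= M%:E)%E -> normc (csum f) <= M.
Proof.
move=> fM; have fa : abs_summable f by apply: le_lt_trans fM (ltry _).
apply: has_sum_bound (abs_summable_has_sum fa) _ => A.
rewrite -lee_fin; apply: le_trans fM; apply: fset_le_esum => i; exact: normc_ge0.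
Qed.

Lemma csumD (I : choiceType) (f g : I -> R[i]) :
  abs_summable f -> abs_summable g ->
  csum (fun i => f i + g i) = csum f + csum g.
Proof.
by move=> fa ga; apply/csumE/has_sumD; apply: abs_summable_has_sum.
Qed.

Lemma csumZ (I : choiceType) (a : R[i]) (f : I -> R[i]) :
  abs_summable f -> csum (fun i => a * f i) = a * csum f.
Proof. by move=> fa; apply/csumE/has_sumZ/abs_summable_has_sum. Qed.

Lemma csum_conj (I : choiceType) (f : I -> R[i]) :
  abs_summable f -> csum (fun i => (f i)^*) = (csum f)^*.
Proof. by move=> fa; apply/csumE/has_sum_conj/abs_summable_has_sum. Qed.

Lemma has_sum0 (I : choiceType) (f : I -> R[i]) :
  (forall i, f i = 0) -> has_sum f 0.
Proof.
move=> f0; apply/has_sumP => e e0; exists fset0 => B _.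
by rewrite big1 ?subr0 ?normc0.
Qed.

Lemma esum_inj (I J : choiceType) (s : J -> I) (g : I -> \bar R) :
  injective s -> (forall i, ~ range s i -> g i = 0%E) ->
  (\esum_(i in [set: I]) g i = \esum_(j in [set: J]) g (s j))%E.
Proof.
move=> sI g0; rewrite -(@esum_image R J I [set: J] s g); last first.
  by move=> x y _ _; exact: sI.
rewrite [RHS]esum_mkcond; apply: eq_esum => i _; case: ifPn => // /negP iN.
by apply: g0 => iR; apply: iN; rewrite inE.
Qed.

(** Reindexing along an injection; used with codings of index sets by nat. *)
Lemma has_sum_inj (I J : choiceType) (s : J -> I) (f : I -> R[i]) t :
  injective s -> (forall i, ~ range s i -> f i = 0) ->
  has_sum (fun j => f (s j)) t -> has_sum f t.
Proof.
move=> sI f0 /has_sumP ft; apply/has_sumP => e /ft[A AP].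
exists (s @` A)%fset => B AB.
pose C := fset_set (s @^-1` [set` B]).
have Cf : finite_set (s @^-1` [set` B]).
  apply: finite_preimage; last exact: finite_fset.
  by move=> x y _ _; exact: sI.
have CB j : (j \in C) = (s j \in B) by rewrite in_fset_set//; apply/idP/idP; rewrite inE.
have -> : \sum_(i <- B) f i = \sum_(j <- C) f (s j).
  rewrite (big_fsetID _ (mem (s @` C)%fset) B) /= [X in _ + X]big1_fset ?addr0.
    have -> : [fset x in B | x \in (s @` C)%fset]%fset = (s @` C)%fset.
      apply/fsetP => x; rewrite !inE /=; apply/andP/idP => [[]//|xC]; split => //.
      by case/imfsetP: xC => j /=; rewrite CB => ? ->.
    by rewrite big_imfset//= => x y _ _; exact: sI.
  move=> i; rewrite !inE /= => /andP[iB iN] _; apply: f0 => -[j _ ji].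
  by move/negP: iN; apply; apply/imfsetP; exists j => //=; rewrite CB ji.
apply: AP; apply/fsubsetP => j jA; rewrite CB; apply: (fsubsetP AB).
exact: in_imfset.
Qed.

Lemma abs_summable_inj (I J : choiceType) (s : J -> I) (f : I -> R[i]) :
  injective s -> (forall i, ~ range s i -> f i = 0) ->
  abs_summable (fun j => f (s j)) -> abs_summable f.
Proof.
move=> sI f0; rewrite /abs_summable (esum_inj (g := fun i => (normc (f i))%:E) sI)//.
by move=> i /f0 ->; rewrite normc0.
Qed.

Lemma csum_inj (I J : choiceType) (s : J -> I) (f : I -> R[i]) :
  injective s -> (forall i, ~ range s i -> f i = 0) ->
  abs_summable f -> csum f = csum (fun j => f (s j)).
Proof.
move=> sI f0 fa; apply/csumE/(has_sum_inj sI f0)/abs_summable_has_sum.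
move: fa; rewrite /abs_summable (esum_inj (g := fun i => (normc (f i))%:E) sI)//.
by move=> i /f0 ->; rewrite normc0.
Qed.

Lemma has_sum_finite (I : choiceType) (f : I -> R[i]) (s : seq I) : uniq s ->
  (forall i, i \notin s -> f i = 0) -> has_sum f (\sum_(i <- s) f i).
Proof.
move=> us f0; apply/has_sumP => e e0; exists [fset i in s]%fset => B sB.
have -> : \sum_(i <- B) f i = \sum_(i <- s) f i.
  rewrite (big_fsetID _ (mem [fset i in s]%fset) B) /= [X in _ + X]big1_fset ?addr0.
    apply: perm_big; apply: uniq_perm => // i.
    rewrite !inE /=; apply/andP/idP => [[]//|iS].
    by split => //; apply: (fsubsetP sB); rewrite inE.
  by move=> i; rewrite !inE /= => /andP[_ /f0].
by rewrite subrr normc0.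
Qed.

Lemma has_sum1 (I : choiceType) (k : I) (f : I -> R[i]) :
  (forall i, i != k -> f i = 0) -> has_sum f (f k).
Proof.
move=> f0; rewrite -(big_seq1 +%R k f); apply: has_sum_finite => // i.
by rewrite inE => /f0.
Qed.

(** The partial sum of g over B is close to the sum of f over a rectangle with
    base B, and large rectangles have sums close to s. *)
Lemma has_sum_fubini (I J : choiceType) (f : I * J -> R[i]) s (g : I -> R[i]) :
  has_sum f s -> (forall i, has_sum (fun j => f (i, j)) (g i)) -> has_sum g s.
Proof.
move=> /has_sumP fs fg; apply/has_sumP => e e0.
have e20 : 0 < e / 2 by rewrite divr_gt0.
have [A AP] := fs _ e20; exists [fset p.1 | p in A]%fset => B AB.
have cB : (fun G : {fset J} => \sum_(i <- B) \sum_(j <- G) f (i, j) : R[i]^o)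
    @ summability.totally --> (\sum_(i <- B) g i : R[i]^o).
  by apply: cvg_big => //=; [exact: add_continuous|move=> i _; exact: fg].
move: cB => /(@cvgrPdist_lt _ R[i]^o) /(_ (e / 2)%:C).
rewrite ltcR => /(_ e20)[G _ GP].
pose H := (G `|` [fset p.2 | p in A])%fset.
have := GP H (fsubsetUl _ _); rewrite /= normcE ltcR => BH.
have pairs : \sum_(i <- B) \sum_(j <- H) f (i, j) =
    \sum_(p <- (B `*` H)%fset) f p.
  rewrite -big_allpairs; apply: perm_big.
  apply: uniq_perm; [|exact: fset_uniq|].
    by apply: allpairs_uniq => //; move=> [? ?] [? ?] _ _ [-> ->].
  move=> [i j]; rewrite in_fsetM /=; apply/allpairsP/andP => [[[k l]/= [? ? [-> ->]]]//|].
  by move=> [iB jH]; exists (i, j).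
have := AP (B `*` H)%fset; rewrite -pairs => /(_ _) sH.
rewrite -(subrK (\sum_(i <- B) \sum_(j <- H) f (i, j)) s) -addrA.
apply: le_lt_trans (le_normcD _ _) _; rewrite [e]splitr; apply: ltrD.
  apply: sH; apply/fsubsetP => -[i j] ijA; rewrite in_fsetM /= inE.
  apply/andP; split; last by apply/orP; right; apply/imfsetP; exists (i, j).
  by apply: (fsubsetP AB); apply/imfsetP; exists (i, j).
by rewrite -normcN opprB.
Qed.

Lemma abs_summable_row (I J : choiceType) (f : I * J -> R[i]) i :
  abs_summable f -> abs_summable (fun j => f (i, j)).
Proof.
apply: le_lt_trans; rewrite -(esum_image [set: J] (fun j => (i, j)) (fun p => (normc (f p))%:E)).
  rewrite [X in (X <= _)%E]esum_mkcond; apply: le_esum => p _.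
  by case: ifP; rewrite // lee_fin normc_ge0.
by move=> ? ? _ _ [].
Qed.

Lemma csum_fubini (I J : choiceType) (f : I * J -> R[i]) :
  abs_summable f -> csum f = csum (fun i => csum (fun j => f (i, j))).
Proof.
move=> fa; apply/esym/csumE/(has_sum_fubini (abs_summable_has_sum fa)) => i.
exact/abs_summable_has_sum/abs_summable_row.
Qed.

Definition swap_pair (A B : Type) (p : A * B) := (p.2, p.1).

Lemma swap_pair_inj (A B : Type) : injective (@swap_pair A B).
Proof. by move=> [? ?] [? ?] [-> ->]. Qed.

Lemma swap_pair_range (A B : Type) (p : B * A) : range (@swap_pair A B) p.
Proof. by case: p => b a; exists (a, b). Qed.

Lemma csum_fubini_swap (I J : choiceType) (f : I * J -> R[i]) :
  abs_summable f -> csum f = csum (fun j => csum (fun i => f (i, j))).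
Proof.
move=> fa; rewrite (@csum_inj _ _ (@swap_pair J I)) //; first last.
- by move=> p; case; exact: swap_pair_range.
- exact: swap_pair_inj.
rewrite csum_fubini //; apply: (@abs_summable_inj _ _ (@swap_pair I J)) => //.
- exact: swap_pair_inj.
- by move=> p; case; exact: swap_pair_range.
- by apply: le_lt_trans fa; apply: le_esum => -[i j].
Qed.

Lemma abs_summable_prod (I J : choiceType) (f : I -> R[i]) (g : J -> R[i]) :
  abs_summable f -> abs_summable g -> abs_summable (fun p => f p.1 * g p.2).
Proof.
move=> fa ga; rewrite /abs_summable.
rewrite (eq_esum (b := fun p => (normc (f p.1) * normc (g p.2))%:E)); last first.
  by move=> p _; rewrite normcM.
have -> : [set: I * J] = [set: I] `*`` (fun=> [set: J]) by apply/seteqP; split.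
rewrite -(@esum_esum _ _ _ _ _ (fun i j => (normc (f i) * normc (g j))%:E)); last first.
  by move=> i j _ _; rewrite lee_fin mulr_ge0 ?normc_ge0.
set G := (\esum_(j in [set: J]) (normc (g j))%:E)%E in ga.
have G0 : (0 <= G)%E by apply: esum_ge0 => j _; rewrite lee_fin normc_ge0.
have Gf : G \is a fin_num by rewrite ge0_fin_numE.
rewrite (eq_esum (b := fun i => ((fine G)%:E * (normc (f i))%:E)%E)); last first.
  move=> i _; rewrite fineK// muleC -esumZl ?normc_ge0//.
  by move=> j; rewrite lee_fin normc_ge0.
rewrite esumZl ?fine_ge0//; last by move=> j; rewrite lee_fin normc_ge0.
by apply: lte_mul_pinfty => //; rewrite lee_fin fine_ge0.
Qed.

Lemma csum_prod (I J : choiceType) (f : I -> R[i]) (g : J -> R[i]) :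
  abs_summable f -> abs_summable g ->
  csum (fun p => f p.1 * g p.2) = csum f * csum g.
Proof.
move=> fa ga; rewrite csum_fubini /=; last exact: abs_summable_prod.
rewrite [X in csum X](_ : _ = fun i => csum g * f i); last first.
  by apply/funext => i; rewrite csumZ// mulrC.
by rewrite csumZ// mulrC.
Qed.

Lemma esum_swap (I K : choiceType) (a : I -> K -> \bar R) :
  (forall i k, 0 <= a i k)%E ->
  (\esum_(i in [set: I]) \esum_(k in [set: K]) a i k =
   \esum_(k in [set: K]) \esum_(i in [set: I]) a i k)%E.
Proof.
move=> a0; rewrite esum_esum// [RHS]esum_esum//.
rewrite (@reindex_esum _ _ _ ([set: K] `*`` (fun=> [set: I])) _ (@swap_pair K I)) //.
split=> //; first by move=> p q _ _; exact: swap_pair_inj.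
by move=> p _; have [q _ <-] := swap_pair_range p; exists q.
Qed.

Lemma seq_le_esum (I : choiceType) (s : seq I) (g : I -> R) : uniq s ->
  (forall i, 0 <= g i) -> ((\sum_(i <- s) g i)%:E <= \esum_(i in [set: I]) (g i)%:E)%E.
Proof.
move=> us g0; apply: le_trans (fset_le_esum [fset i in s]%fset g0).
rewrite lee_fin le_eqVlt; apply/orP; left; apply/eqP/perm_big/uniq_perm => // i.
by rewrite inE.
Qed.

End UnconditionalSums.

(** * The inner product of l^2 *)

Section InnerProduct.
Variables (R : realType) (I : choiceType).
Implicit Types x y z : ell2 R I.

Lemma ell2_ext x y : (forall i, x i = y i) -> x = y.
Proof. by move=> xy; apply/val_inj/funext. Qed.

Lemma ell2_fin x : (sqnorm x < +oo)%E.
Proof. exact: (valP x). Qed.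

Lemma ell2DE x y i : (x + y) i = x i + y i. Proof. by []. Qed.
Lemma ell2ZE a x i : (a *: x) i = a * x i. Proof. by []. Qed.
Lemma ell2BE x y i : (x - y) i = x i - y i. Proof. by []. Qed.
Lemma ell20E i : (0 : ell2 R I) i = 0. Proof. by []. Qed.

Lemma bopDE (A B : bop R I) x : (A + B) x = A x + B x. Proof. by []. Qed.
Lemma bopZE a (A : bop R I) x : (a *: A) x = a *: A x. Proof. by []. Qed.
Lemma bopBE (A B : bop R I) x : (A - B) x = A x - B x. Proof. by []. Qed.
Lemma bop0E x : (0 : bop R I) x = 0. Proof. by []. Qed.
Lemma bopME (A B : bop R I) x : (A * B) x = A (B x). Proof. by []. Qed.

Lemma bop_map0 (A : bop R I) : A 0 = 0.
Proof. by rewrite -[X in A X](scale0r 0) bopZ scale0r. Qed.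

Lemma bop_scaleAl a (A B : bop R I) : (a *: A) * B = a *: (A * B).
Proof. exact: bop_ext. Qed.

Lemma bop_scaleAr a (A B : bop R I) : A * (a *: B) = a *: (A * B).
Proof. by apply: bop_ext => x; rewrite bopZE !bopME bopZ. Qed.

Lemma bop_sumE (T : Type) (s : seq T) (A : T -> bop R I) x :
  (\sum_(t <- s) A t) x = \sum_(t <- s) A t x.
Proof. by elim/big_rec2: _ => // t y B _ <-. Qed.

Lemma ell2_sumE (T : Type) (s : seq T) (x : T -> ell2 R I) i :
  (\sum_(t <- s) x t) i = \sum_(t <- s) x t i.
Proof. by elim/big_rec2: _ => // t y B _ <-. Qed.

Lemma normc_conj (a : R[i]) : normc a^* = normc a.
Proof. by case: a => u v /=; rewrite sqrrN. Qed.

Lemma normc_mul_le (a b : R[i]) : normc (a * b^*) <= abs2 a + abs2 b.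
Proof.
rewrite normcM normc_conj !abs2E.
have := normc_ge0 a; have := normc_ge0 b; move: (normc a) (normc b) => u v u0 v0.
by nra.
Qed.

Lemma inner_esum_le x y :
  (\esum_(i in [set: I]) (normc (x i * (y i)^*))%:E <= sqnorm x + sqnorm y)%E.
Proof.
rewrite -esumD; [|by move=> i _; rewrite lee_fin abs2_ge0..].
by apply: le_esum => i _; rewrite -EFinD lee_fin normc_mul_le.
Qed.

Lemma inner_summable x y : abs_summable (fun i => x i * (y i)^*).
Proof.
by apply: le_lt_trans (inner_esum_le _ _) _; rewrite lte_add_pinfty ?ell2_fin.
Qed.

Lemma innerE x y : inner x y = csum (fun i => x i * (y i)^*).
Proof. by []. Qed.

Lemma innerDl x y z : inner (x + y) z = inner x z + inner y z.
Proof.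
rewrite !innerE -csumD; [|exact: inner_summable..].
by congr csum; apply/funext => i; rewrite ell2DE mulrDl.
Qed.

Lemma innerZl a x z : inner (a *: x) z = a * inner x z.
Proof.
rewrite !innerE -csumZ; last exact: inner_summable.
by congr csum; apply/funext => i; rewrite ell2ZE mulrA.
Qed.

Lemma inner_conj x y : inner y x = (inner x y)^*.
Proof.
rewrite !innerE -csum_conj; last exact: inner_summable.
by congr csum; apply/funext => i; rewrite rmorphM /= conjcK mulrC.
Qed.

Lemma innerDr x y z : inner z (x + y) = inner z x + inner z y.
Proof. by rewrite inner_conj innerDl rmorphD /= -!inner_conj. Qed.

Lemma innerZr a x z : inner z (a *: x) = a^* * inner z x.
Proof. by rewrite inner_conj innerZl rmorphM /= -inner_conj. Qed.

Lemma innerNl x z : inner (- x) z = - inner x z.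
Proof. by rewrite -(scaleN1r x) innerZl mulN1r. Qed.

Lemma innerBl x y z : inner (x - y) z = inner x z - inner y z.
Proof. by rewrite innerDl innerNl. Qed.

Lemma inner0l z : inner 0 z = 0.
Proof. by rewrite -[X in inner X _](scale0r 0) innerZl mul0r. Qed.

Lemma inner0r z : inner z 0 = 0.
Proof. by rewrite inner_conj inner0l conjc0. Qed.

Lemma innerBr x y z : inner z (x - y) = inner z x - inner z y.
Proof. by rewrite inner_conj innerBl rmorphB /= -!inner_conj. Qed.

Lemma inner_suml (T : Type) (s : seq T) (x : T -> ell2 R I) z :
  inner (\sum_(t <- s) x t) z = \sum_(t <- s) inner (x t) z.
Proof.
by elim/big_rec2: _ => [|t y B _ <-]; rewrite ?inner0l// innerDl.
Qed.

(** The arithmetic-geometric form of the Cauchy-Schwarz inequality; rescaling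
    the two arguments makes it as strong as needed. *)
Lemma inner_le x y (a b : R) : (sqnorm x <= a%:E)%E -> (sqnorm y <= b%:E)%E ->
  normc (inner x y) <= a + b.
Proof.
move=> xa yb; apply: csum_bound; apply: le_trans (inner_esum_le _ _) _.
by rewrite EFinD leeD.
Qed.

Lemma inner_single x y i : (forall j, j != i -> y j = 0) ->
  inner x y = x i * (y i)^*.
Proof.
move=> y0; apply: csumE.
by apply: (has_sum1 (f := fun i => x i * (y i)^*)) => j /y0 yj /=; rewrite yj rmorph0 mulr0.
Qed.

Lemma xiE (i j : I) : xi R i j = (j == i)%:R. Proof. by []. Qed.

Lemma inner_xi x i : inner x (xi R i) = x i.
Proof.
rewrite (@inner_single _ _ i) => [|j /negbTE ji]; last by rewrite xiE ji.
by rewrite xiE eqxx rmorph1 mulr1.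
Qed.

Lemma inner_self0 x : inner x x = 0 -> x = 0.
Proof.
move=> xx0; apply: ell2_ext => i; apply/eq0_normc/eqP; rewrite -sqrf_eq0 -abs2E.
rewrite eq_le abs2_ge0 andbT; apply/ler_addgt0Pr => e e0; rewrite add0r.
have := abs_summable_has_sum (inner_summable x x); rewrite -innerE xx0.
move=> /has_sumP /(_ e e0)[A /(_ (i |` A)%fset (fsubsetU1 _ _))].
have -> : \sum_(j <- (i |` A)%fset) x j * (x j)^* = (\sum_(j <- (i |` A)%fset) abs2 (x j))%:C.
  rewrite rmorph_sum; apply: eq_bigr => j _ /=.
  by rewrite /abs2 add_Re2_Im2 normCK.
rewrite sub0r normcN /= expr0n addr0 sqrtr_sqr => /ltW; apply: le_trans.
rewrite ger0_norm; last by apply: sumr_ge0 => j _; exact: abs2_ge0.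
rewrite (big_fsetD1 i) ?fset1U1//= lerDl; apply: sumr_ge0 => j _; exact: abs2_ge0.
Qed.

End InnerProduct.

(** * Convergence in the weak operator and weak-star topologies *)

Section InitialTopologies.
Variable R : realType.

Lemma cvg_initial (S : choiceType) (T : topologicalType) (m : S -> T)
    (F : set_system S) (s : S) : Filter F ->
  F --> (s : initial_topology m) <-> m @ F --> m s.
Proof.
move=> FF; split=> [Fs|ms].
  move=> U /(@initial_continuous S T m s); exact: Fs.
move=> U [? [[W oW <-]] /= Wms] /filterS; apply; apply: ms.
exact: open_nbhs_nbhs.
Qed.

(** The weak operator and weak-star topologies are initial topologies of this
    kind, so that convergence is convergence of each defining functional. *)
Lemma cvg_initial_ptws (S : choiceType) (T : Type) (m : S -> {ptws T -> R[i]^o})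
    (F : set_system S) (s : S) : Filter F ->
  F --> (s : initial_topology m) <-> forall p, (fun x => m x p) @ F --> m s p.
Proof.
move=> FF; rewrite cvg_initial cvg_sup; split=> H p.
  exact: (proj1 (cvg_initial (fun f : T -> R[i]^o => f p) _ _) (H p)).
by apply/(cvg_initial (fun f : T -> R[i]^o => f p)); exact: H.
Qed.

Variable I : choiceType.

Lemma wot_continuous (p q : ell2 R I) :
  continuous ((fun T : bop R I => inner (T p) q) : wot R I -> R[i]^o).
Proof.
move=> T; have FF : Filter (nbhs (T : wot R I)) by exact: nbhs_filter.
exact: (proj1 (@cvg_initial_ptws (bop R I) _ (@wot_map R I) _ T FF) _ (p, q)).
Qed.

Lemma wot_cvg (F : set_system (bop R I)) (T : bop R I) : Filter F ->
  (forall p q, (fun A : bop R I => inner (A p) q : R[i]^o) @ F --> (inner (T p) q : R[i]^o)) ->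
  F --> (T : wot R I).
Proof.
move=> FF H; apply/(@cvg_initial_ptws (bop R I) _ (@wot_map R I)) => -[p q].
exact: H.
Qed.

Lemma wstar_on_cvg (M : set (bop R I)) (F : set_system M) (A : M) : Filter F ->
  F --> (A : wstar_on M) <->
  forall p, (fun B : M => wstar_map (\val B) p) @ F --> wstar_map (\val A) p.
Proof.
move=> FF; rewrite (cvg_initial (fun B : M => \val B : wstar R I)).
exact: (@cvg_initial_ptws (bop R I) _ (@wstar_map R I)).
Qed.

End InitialTopologies.

(** * Vector functionals on amplifications *)

Section Extension.
Variables (R : realType) (I J : choiceType) (s : J -> I) (t : I -> option J).
Hypotheses (sK : pcancel s t) (tK : ocancel t s).

Definition extend_fun (x : J -> R[i]) (i : I) : R[i] := oapp x 0 (t i).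

Let s_inj : injective s := pcan_inj sK.

Lemma off_range i : ~ range s i -> t i = None.
Proof. by move=> iN; have := tK i; case: (t i) => //= j ji; case: iN; exists j. Qed.

Lemma sqnorm_extend x : sqnorm (extend_fun x) = sqnorm x.
Proof.
rewrite /sqnorm (esum_inj s_inj); last first.
  by move=> i /off_range; rewrite /extend_fun => -> /=; rewrite /abs2 /= expr0n addr0.
by apply: eq_esum => j _; rewrite /extend_fun sK.
Qed.

Lemma extend_subproof (x : ell2 R J) : extend_fun x \in @sqsum R I.
Proof. by rewrite inE sqnorm_extend; exact: ell2_fin. Qed.

(** Extension by 0 of x along the injection s; the partial inverse t decides
    which points are in the image. *)
Definition extend x : ell2 R I := Ell2 _ (extend_subproof x).

Lemma extendE x j : extend x (s j) = x j.
Proof. by rewrite /= /extend_fun sK. Qed.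

Lemma inner_extend z y : inner z (extend y) = csum (fun j => z (s j) * (y j)^*).
Proof.
rewrite innerE (csum_inj s_inj); last exact: inner_summable.
  by congr csum; apply/funext => j; rewrite extendE.
by move=> i /off_range iN; rewrite /= /extend_fun iN /= rmorph0 mulr0.
Qed.

End Extension.

Section Stack.
Variables (R : realType) (I K : choiceType) (x : K -> ell2 R I).
Hypothesis xfin : (\esum_(k in [set: K]) sqnorm (x k) < +oo)%E.

Lemma stack_subproof : (fun p => x p.2 p.1) \in @sqsum R (I * K)%type.
Proof. by rewrite inE -sqnorm_cols. Qed.

Definition stack : ell2 R (I * K)%type := Ell2 _ stack_subproof.

Lemma stack_col k : ell2_col stack k = x k.
Proof. exact: ell2_ext. Qed.

End Stack.

Section Amplification.
Variables (R : realType) (I : choiceType).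

(** The vector functional of X and Y on the amplification A (x) 1; for K = nat
    these are the functionals that define the weak-star topology. *)
Definition omega (K : choiceType) (X Y : ell2 R (I * K)%type) (A : bop R I) : R[i] :=
  inner (tensl_fun A X) Y.

Lemma omega_cols (K : choiceType) (X Y : ell2 R (I * K)%type) A :
  omega X Y A = csum (fun k => inner (A (ell2_col X k)) (ell2_col Y k)).
Proof. by rewrite /omega innerE csum_fubini_swap //; exact: inner_summable. Qed.

Lemma ell2_colD (K : choiceType) (X Y : ell2 R (I * K)%type) k :
  ell2_col (X + Y) k = ell2_col X k + ell2_col Y k.
Proof. exact/ell2_ext. Qed.

Lemma ell2_colZ (K : choiceType) a (X : ell2 R (I * K)%type) k :
  ell2_col (a *: X) k = a *: ell2_col X k.
Proof. exact/ell2_ext. Qed.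

Lemma omegaP (K : choiceType) (X Y : ell2 R (I * K)%type) a (A B : bop R I) :
  omega X Y (a *: A + B) = a * omega X Y A + omega X Y B.
Proof.
rewrite /omega -(innerZl a (tensl_fun A X)) -innerDl; congr (inner _ Y).
by apply: ell2_ext => -[i k].
Qed.

Lemma omega0 (K : choiceType) (X Y : ell2 R (I * K)%type) : omega X Y 0 = 0.
Proof.
by rewrite /omega -[RHS](inner0l Y); congr inner; exact: ell2_ext.
Qed.

Lemma omega_sum (K : choiceType) (X Y : ell2 R (I * K)%type) (T : Type)
    (l : seq T) (c : T -> R[i]) (A : T -> bop R I) :
  omega X Y (\sum_(t <- l) c t *: A t) = \sum_(t <- l) c t * omega X Y (A t).
Proof.
elim: l => [|t l IHl]; first by rewrite !big_nil omega0.
by rewrite !big_cons omegaP IHl.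
Qed.

Lemma omegaZl (K : choiceType) (X Y : ell2 R (I * K)%type) a A :
  omega (a *: X) Y A = a * omega X Y A.
Proof.
rewrite /omega -(innerZl a (tensl_fun A X)); congr (inner _ Y).
apply: ell2_ext => -[i k] /=.
by rewrite ell2_colZ bopZ.
Qed.

Lemma omegaZr (K : choiceType) (X Y : ell2 R (I * K)%type) a A :
  omega X (a *: Y) A = a^* * omega X Y A.
Proof. exact: innerZr. Qed.

Lemma omegaBr (K : choiceType) (X Y Y' : ell2 R (I * K)%type) A :
  omega X (Y - Y') A = omega X Y A - omega X Y' A.
Proof. exact: innerBr. Qed.

Lemma cols_sqsummable (X : ell2 R (I * nat)%type) :
  @sqsummable_seq R I (ell2_col X).
Proof. by rewrite /sqsummable_seq /= sqnorm_cols; exact: ell2_fin. Qed.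

Definition cols (X : ell2 R (I * nat)%type) : @sqsummable_seq R I :=
  SigSub (mem_set (cols_sqsummable X)).

Lemma wstar_map_cols (X Y : ell2 R (I * nat)%type) A :
  wstar_map A (cols X, cols Y) = omega X Y A.
Proof. by rewrite omega_cols. Qed.

Lemma wstar_map_stack (p : (@sqsummable_seq R I * @sqsummable_seq R I)%type) :
  exists X Y : ell2 R (I * nat)%type, forall A, wstar_map A p = omega X Y A.
Proof.
exists (stack (set_valP p.1)), (stack (set_valP p.2)) => A.
rewrite omega_cols; congr csum; apply/funext => n.
by rewrite !stack_col.
Qed.

(** The two vectors, read by columns, index one of the maps defining the topology. *)
Lemma omega_continuous (M : set (bop R I)) (X Y : ell2 R (I * nat)%type) :
  continuous ((fun A : M => omega X Y (\val A)) : wstar_on M -> R[i]^o).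
Proof.
move=> A; have FF : Filter (nbhs (A : wstar_on M)) by exact: nbhs_filter.
have := proj1 (@wstar_on_cvg R I M _ A FF) (fun U => id) (cols X, cols Y).
rewrite wstar_map_cols (_ : (fun _ => _) = fun B : M => omega X Y (\val B)) //.
by apply/funext => B; rewrite wstar_map_cols.
Qed.

(** Merges a sequence of vectors over I * nat into one vector, coding pairs by nat. *)
Definition glue_idx (p : (I * nat) * nat) : I * nat :=
  (p.1.1, choice.pickle (p.1.2, p.2)).
Definition glue_inv (p : I * nat) : option ((I * nat) * nat) :=
  omap (fun q => ((p.1, q.1), q.2)) (@pickle_inv (nat * nat)%type p.2).

Lemma glue_idxK : pcancel glue_idx glue_inv.
Proof. by move=> [[i k] n]; rewrite /glue_inv /= pickleK_inv. Qed.

Lemma glue_invK : ocancel glue_inv glue_idx.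
Proof.
move=> [i m]; rewrite /glue_inv /=; have := @pickle_invK (nat * nat)%type m.
by case: (pickle_inv m) => //= -[k n] /= <-.
Qed.

Definition glue (X : nat -> ell2 R (I * nat)%type)
    (Xfin : sqsummable_seq X) : ell2 R (I * nat)%type :=
  extend glue_idxK glue_invK (stack Xfin).

Lemma glueE (X : nat -> ell2 R (I * nat)%type) (Xfin : sqsummable_seq X) i k n :
  glue Xfin (i, choice.pickle (k, n)) = X n (i, k).
Proof. exact: (extendE glue_idxK glue_invK (stack Xfin) ((i, k), n)). Qed.

Lemma glue_col (X : nat -> ell2 R (I * nat)%type) (Xfin : sqsummable_seq X) k n :
  ell2_col (glue Xfin) (choice.pickle (k, n)) = ell2_col (X n) k.
Proof. by apply: ell2_ext => i; exact: glueE. Qed.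

Lemma glue_col_eq (X : nat -> ell2 R (I * nat)%type) (Xfin : sqsummable_seq X) m :
  ell2_col (glue Xfin) m = 0 \/ exists k n, ell2_col (glue Xfin) m = ell2_col (X n) k.
Proof.
case Em : (@pickle_inv (nat * nat)%type m) => [[k n]|].
  right; exists k, n; rewrite -glue_col; congr ell2_col.
  by have := @pickle_invK (nat * nat)%type m; rewrite Em.
by left; apply: ell2_ext => i /=; rewrite /extend_fun /glue_inv /= Em.
Qed.

(** Fubini: a square summable sequence of functionals has a sum, again a vector functional. *)
Lemma omega_glue (X Y : nat -> ell2 R (I * nat)%type) (Xfin : sqsummable_seq X)
    (Yfin : sqsummable_seq Y) A :
  omega (glue Xfin) (glue Yfin) A = csum (fun n => omega (X n) (Y n) A).
Proof.
rewrite /omega inner_extend.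
have E : (fun j => tensl_fun A (glue Xfin) (glue_idx j) * (stack Yfin j)^*) =
    (fun p => tensl_fun A (X p.2) p.1 * (Y p.2 p.1)^*).
  by apply/funext => -[[i k] n]; rewrite /= glue_col.
rewrite E csum_fubini_swap //.
have TXfin : (\esum_(n in [set: nat]) sqnorm (tensl_fun A (X n)) < +oo)%E.
  have [_ [D D0 AD]] := bopP A.
  apply: le_lt_trans (_ : (\esum_(n in [set: nat]) (D%:E * sqnorm (X n)) < +oo)%E).
    by apply: le_esum => n _; exact: sqnorm_tensl.
  by rewrite esumZl // ?lte_mul_pinfty ?lee_fin// => n; exact: sqnorm_ge0.
exact: (inner_summable (stack TXfin) (stack Yfin)).
Qed.

(** A sum of two functionals is the gluing of a sequence with two nonzero entries. *)
Lemma omegaD (X Y X' Y' : ell2 R (I * nat)%type) : exists Z W : ell2 R (I * nat)%type,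
  forall A, omega Z W A = omega X Y A + omega X' Y' A.
Proof.
pose two (x x' : ell2 R (I * nat)%type) (n : nat) := nth 0 [:: x; x'] n.
have two_fin x x' : (\esum_(n in [set: nat]) sqnorm (two x x' n) < +oo)%E.
  rewrite (esumID [set` [fset 0%N; 1%N]%fset]) //; last by move=> n _; exact: sqnorm_ge0.
  rewrite setTI [X in (_ + X)%E]esum1 ?adde0.
    rewrite esum_fset //=; last by move=> n _; exact: sqnorm_ge0.
    by rewrite fsbig_finite //= set_fsetK big_fsetU1 ?inE//= big_seq_fset1 lte_add_pinfty ?ell2_fin.
  case=> [[] _ []|[[] _ []|n _]]; rewrite /= ?inE //.
  by rewrite /two /= nth_nil sqnorm0.
exists (glue (two_fin X X')), (glue (two_fin Y Y')) => A; rewrite omega_glue.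
apply: csumE; rewrite -[X in has_sum _ X]addr0.
have := @has_sum_finite R nat (fun n => omega (two X X' n) (two Y Y' n) A) [:: 0%N; 1%N] isT.
rewrite !big_cons big_nil addrA; apply => -[//|[//|n _]].
by rewrite /two /= nth_nil /omega inner0r.
Qed.

End Amplification.

(** * Weak-star continuous functionals are vector functionals *)

Section FiniteKernel.
Variables (K : fieldType) (V : lmodType K) (M : set V).
Hypothesis M_closed : forall a x y, M x -> M y -> M (a *: x + y).

Definition linear_in (f : V -> K) : Prop :=
  forall a x y, M x -> M y -> f (a *: x + y) = a * f x + f y.

(** By induction on fs: either f vanishes on the common kernel of the others and
    can be dropped, or a multiple of f is subtracted from phi. The conclusion is
    phrased with a class Q stable under combinations instead of coefficients. *)
Lemma finite_kernel (Q : (V -> K) -> Prop) (fs : seq (V -> K)) (phi : V -> K) :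
  Q (fun=> 0) -> (forall f g c, Q f -> Q g -> Q (fun x => f x + c * g x)) ->
  (forall f, List.In f fs -> Q f /\ linear_in f) -> linear_in phi ->
  (forall x, M x -> (forall f, List.In f fs -> f x = 0) -> phi x = 0) ->
  exists2 g, Q g & forall x, M x -> phi x = g x.
Proof.
move=> Q0 QD; elim: fs phi => [|f fs IHfs] phi fsQ phil phi0.
  by exists (fun=> 0) => // x Mx; exact: phi0.
have [Qf fl] := fsQ f (or_introl erefl).
have [[a [Ma fsa fa]]|fred] := pselect (exists a, [/\ M a,
    forall g, List.In g fs -> g a = 0 & f a != 0]); last first.
  apply: IHfs => // [g gfs|x Mx fsx]; first by apply: fsQ; right.
  apply: phi0 => // g [<-|]; last exact: fsx.
  by apply/eqP/negP => /negP fx; apply: fred; exists x.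
pose c := phi a / f a.
have [||x Mx fsx|g Qg gP] := IHfs (fun x => phi x - c * f x).
- by move=> g gfs; apply: fsQ; right.
- by move=> b x y Mx My; rewrite phil// fl//; ring.
- have fsl g b u v : List.In g fs -> M u -> M v -> g (b *: u + v) = b * g u + g v.
    by move=> gfs; apply: (proj2 (fsQ g _)); right.
  have : phi (- (f x / f a) *: a + x) = 0.
    apply: phi0 => [|g [<-|gfs]]; first exact: M_closed.
      by rewrite fl// mulNr mulfVK// addNr.
    by rewrite fsl// (fsx _ gfs) (fsa _ gfs) mulr0 addr0.
  by rewrite phil// => <-; rewrite /c; ring.
exists (fun x => g x + c * f x); first exact: QD.
by move=> x Mx; rewrite -gP// subrK.
Qed.

End FiniteKernel.

Lemma linear_on0 (R : realType) (V W : lmodType R[i]) (M : set V) (f : M -> W) (z : M) :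
  linear_on f -> \val z = 0 -> f z = 0.
Proof.
move=> fl z0; have := fl (-1) z z z; rewrite z0 scaler0 addr0 => /(_ erefl).
by rewrite scaleN1r addNr.
Qed.

Section Predual.
Variables (R : realType) (I : choiceType) (M : set (bop R I)).
Hypothesis M_sub : Defs.subspace M.

Lemma mk_elt (A : bop R I) : M A -> exists B : M, \val B = A.
Proof. by move=> MA; exists (SigSub (mem_set MA)). Qed.

Lemma val_in (A : M) : M (\val A).
Proof. exact: set_valP. Qed.

Let M0 : M 0 := proj1 M_sub.
Let MD := proj2 M_sub.

(** If every finite set of defining functionals had a common zero A with
    phi A = 1, these A would form a filter converging to 0, against the
    continuity of phi at 0. *)
Lemma predual_kernel (phi : M -> R[i]^o) : predual M phi ->
  exists ps : seq (@sqsummable_seq R I * @sqsummable_seq R I),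
    forall A : M, (forall p, List.In p ps -> wstar_map (\val A) p = 0) -> phi A = 0.
Proof.
move=> [phil phic]; apply: contrapT => /forallNP noker.
pose vanish ps (A : M) := (forall p, List.In p ps -> wstar_map (\val A) p = 0).
have van1 ps : exists A : M, vanish ps A /\ phi A = 1.
  have /existsNP[A /not_implyP[Aps /eqP phiA]] := noker ps.
  have [B BA] := mk_elt (MD (phi A)^-1 (val_in A) M0).
  rewrite addr0 in BA; exists B; split; last first.
    have [z z0] := mk_elt M0; rewrite (phil (phi A)^-1 A z) ?z0 ?addr0//.
    by rewrite (linear_on0 phil z0) addr0; exact: mulVf.
  move=> p pps; have [X [Y XY]] := wstar_map_stack p.
  rewrite XY BA -[_ *: _]addr0 omegaP omega0 addr0 -XY.
  by rewrite (Aps _ pps) mulr0.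
pose F := filter_from setT (fun ps => [set A | vanish ps A /\ phi A = 1]).
have FF : ProperFilter F.
  apply: filter_from_proper; last by move=> ps _; have [A] := van1 ps; exists A.
  apply: filter_fromT_filter; first by exists [::].
  move=> ps qs; exists (ps ++ qs) => A [Av A1]; split; split=> // p pin;
    by apply: Av; apply/List.in_app_iff; first [by left|by right].
have [z z0] := mk_elt M0.
have Fz : F --> (z : wstar_on M).
  apply/wstar_on_cvg => p; have [X [Y XY]] := wstar_map_stack p.
  rewrite z0 XY omega0; apply/(@cvgrPdist_lt _ R[i]^o) => e e0.
  by exists [:: p] => // A [/(_ p (or_introl erefl)) /= -> _]; rewrite subrr normr0.
have phiF : phi @ F --> phi z by move=> U /(phic z); exact: Fz.
move: phiF => /(@cvgrPdist_lt _ R[i]^o)/(_ 1 ltr01) [ps _ /(_ _)]/=.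
have [A AP] := van1 ps => /(_ A AP); rewrite (proj2 AP) (linear_on0 phil z0) sub0r normrN normr1.
by rewrite ltxx.
Qed.

Lemma predual_omega (phi : M -> R[i]^o) : predual M phi ->
  exists X Y : ell2 R (I * nat)%type, forall A : M, phi A = omega X Y (\val A).
Proof.
move=> phiM; have [ps psP] := predual_kernel phiM; have [phil _] := phiM.
pose ext (A : bop R I) : R[i] :=
  if pselect (M A) is left MA then phi (SigSub (mem_set MA)) else 0.
have extE (A : M) : ext (\val A) = phi A.
  by rewrite /ext; case: pselect => [MA|/(_ (val_in A))//]; congr phi; exact: val_inj.
pose Q (f : bop R I -> R[i]) := exists X Y : ell2 R (I * nat)%type, f = omega X Y.
have [|||||g [X [Y ->]] gP] := @finite_kernel R[i] (bop R I) M MD Q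
    [seq (fun A : bop R I => wstar_map A p : R[i]) | p <- ps] ext.
- by exists 0, 0; apply/funext => A; rewrite /omega inner0r.
- move=> _ _ c [X [Y ->]] [X' [Y' ->]]; have [Z [W ZW]] := omegaD X Y (c *: X') Y'.
  by exists Z, W; apply/funext => A; rewrite ZW omegaZl.
- move=> f /List.in_map_iff[p [<- _]]; have [X [Y XY]] := wstar_map_stack p.
  split; first by exists X, Y; apply/funext.
  by move=> a A B _ _; rewrite !XY omegaP.
- move=> a A B /mk_elt[A' <-] /mk_elt[B' <-].
  have [C CE] := mk_elt (MD a (val_in A') (val_in B')).
  by rewrite -CE !extE; exact: phil.
- move=> A /mk_elt[A' <-] Aps; rewrite extE; apply: psP => p pps.
  by apply: (Aps (fun A => wstar_map A p)); apply/List.in_map_iff; exists p.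
by exists X, Y => A; rewrite -extE gP//; exact: val_in.
Qed.

Lemma omega_predual (X Y : ell2 R (I * nat)%type) :
  predual M (fun A => omega X Y (\val A)).
Proof.
split; last exact: omega_continuous.
by move=> a x y z ->; rewrite omegaP.
Qed.

Definition omegaM (X Y : ell2 R (I * nat)%type) : predual M :=
  SigSub (mem_set (omega_predual X Y)).

Lemma predualP (phi : predual M) : exists X Y, phi = omegaM X Y.
Proof.
have [X [Y XY]] := predual_omega (set_valP phi).
by exists X, Y; apply/val_inj/funext => A; rewrite XY.
Qed.

End Predual.

(** * Truncation of vectors *)

Section Mask.
Variables (R : realType) (I : choiceType).
Implicit Types (x : ell2 R I) (P : pred I).

Definition mask_fun P (x : I -> R[i]) (i : I) : R[i] := if P i then x i else 0.

Lemma sqnorm_mask_le P (x : I -> R[i]) : (sqnorm (mask_fun P x) <= sqnorm x)%E.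
Proof.
apply: le_esum => i _; rewrite lee_fin /mask_fun; case: ifP => // _.
by rewrite abs20 abs2_ge0.
Qed.

Lemma mask_subproof P x : mask_fun P x \in @sqsum R I.
Proof. by rewrite inE; apply: le_lt_trans (sqnorm_mask_le P x) _; exact: ell2_fin. Qed.

Definition mask P x : ell2 R I := Ell2 _ (mask_subproof P x).

Lemma maskE P x i : mask P x i = if P i then x i else 0. Proof. by []. Qed.

Lemma inner_mask P x y : (forall i, ~~ P i -> x i = 0) -> inner x (mask P y) = inner x y.
Proof.
move=> x0; rewrite !innerE; congr csum; apply/funext => i; rewrite maskE.
by case: ifPn => // /x0 ->; rewrite !mul0r.
Qed.

(** Convergence of the sum of squares: outside a finite set, hence for large
    values of f, little of the norm is left. *)
Lemma sqnorm_tail x (f : I -> nat) (e : R) : 0 < e ->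
  exists p, (sqnorm (mask (fun i => (p <= f i)%N) x) <= e%:E)%E.
Proof.
move=> e0.
have xf : sqnorm x \is a fin_num by rewrite ge0_fin_numE ?ell2_fin// sqnorm_ge0.
have [_ [X [Xf _] <-] XS] := @ub_ereal_sup_adherent _ _ _ e0 xf.
pose p := (\max_(i <- fset_set X) f i).+1; exists p.
pose Q i := (p <= f i)%N.
have split_x : (sqnorm x = sqnorm (mask (fun i => ~~ Q i) x) + sqnorm (mask Q x))%E.
  rewrite /sqnorm -esumD; [|by move=> i _; rewrite lee_fin abs2_ge0..].
  by apply: eq_esum => i _; rewrite !maskE; case: (Q i); rewrite /= abs20 ?add0e ?adde0.
have low : (sqnorm x - e%:E <= sqnorm (mask (fun i => ~~ Q i) x))%E.
  apply: le_trans (ltW XS) _; apply: esum_ge; exists X => //.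
  rewrite !fsbig_finite//= big_seq [leRHS]big_seq; apply: lee_sum => i iX.
  rewrite /mask_fun ifT // /Q /p -ltnNge ltnS.
  by apply: leq_bigmax_seq.
have tf : sqnorm (mask (fun i => ~~ Q i) x) \is a fin_num.
  by rewrite ge0_fin_numE ?ell2_fin// sqnorm_ge0.
move: low; rewrite split_x leeBlDr//.
by rewrite leeD2lE.
Qed.

(** Rescale x by t and y by 1/t in [inner_le], with t chosen so that x contributes e/2. *)
Lemma inner_small (a e : R) : 0 < a -> 0 < e -> exists2 b : R, 0 < b &
  forall x y : ell2 R I, (sqnorm x <= a%:E)%E -> (sqnorm y <= b%:E)%E ->
    normc (inner x y) <= e.
Proof.
move=> a0 e0; pose t := Num.sqrt (e / 2 / a).
have t2 : t ^+ 2 = e / 2 / a by rewrite sqr_sqrtr// !divr_ge0// ltW.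
have t0 : 0 < t by rewrite sqrtr_gt0 !divr_gt0.
exists (e / 2 * t ^+ 2) => [|x y xa yb]; first by rewrite mulr_gt0 ?divr_gt0 ?exprn_gt0.
have -> : inner x y = inner (t%:C *: x) ((t^-1)%:C *: y).
  have -> : inner (t%:C *: x) ((t^-1)%:C *: y) = t%:C * (t^-1)%:C * inner x y.
    by rewrite innerZl innerZr mulrA; congr (_ * _ * _); exact: conjc_real.
  rewrite -rmorphM mulfV ?gt_eqF//.
  by rewrite rmorph1 mul1r.
rewrite [e]splitr; apply: inner_le.
  rewrite sqnormZ abs2_real t2; apply: le_trans (lee_wpmul2l _ xa) _.
    by rewrite lee_fin !divr_ge0 // ltW.
  by rewrite -EFinM lee_fin divfK// gt_eqF.
rewrite sqnormZ abs2_real; apply: le_trans (lee_wpmul2l _ yb) _.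
  by rewrite lee_fin sqr_ge0.
by rewrite -EFinM lee_fin exprVn mulrC mulfK// gt_eqF// exprn_gt0.
Qed.

End Mask.

(** * Convolution over the free monoid and Fourier coefficients *)

Section FreeConvolution.
Variables (R : realType) (d : nat).
Local Notation W := (word d).
Implicit Types (a b x : W -> R[i]) (u v w : W).

(** Multiplication of noncommutative power series, with the words as exponents. *)
Definition conv a x v : R[i] :=
  \sum_(i < (size v).+1) a (take i v) * x (drop i v).

Lemma conv_nil a x : conv a x [::] = a [::] * x [::].
Proof. by rewrite /conv big_ord1. Qed.

Lemma conv_cons a x c v :
  conv a x (c :: v) = a [::] * x (c :: v) + conv (fun u => a (c :: u)) x v.
Proof. by rewrite /conv big_ord_recl. Qed.

Lemma eq_conv a b x y v :
  (forall i, (i <= size v)%N ->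
     a (take i v) * x (drop i v) = b (take i v) * y (drop i v)) ->
  conv a x v = conv b y v.
Proof. by move=> ab; apply: eq_bigr => -[i /= iv] _; exact: ab. Qed.

Lemma convDl a b x v : conv (fun u => a u + b u) x v = conv a x v + conv b x v.
Proof. by rewrite /conv -big_split; apply: eq_bigr => i _; rewrite mulrDl. Qed.

Lemma convZl c a x v : conv (fun u => c * a u) x v = c * conv a x v.
Proof. by rewrite /conv big_distrr /=; apply: eq_bigr => i _; rewrite mulrA. Qed.

(** By induction on the word, using the recursion [conv_cons] in the letter c. *)
Lemma convA a b x v : conv a (conv b x) v = conv (conv a b) x v.
Proof.
elim: v a b => [|c v IHv] a b; first by rewrite !conv_nil; ring.
rewrite conv_cons IHv conv_cons [RHS]conv_cons conv_nil.
rewrite [X in _ = _ + X](@eq_conv _ (fun u => a [::] * b (c :: u) +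
  conv (fun u => a (c :: u)) b u) x x); last by move=> i _; rewrite conv_cons.
by rewrite convDl convZl; ring.
Qed.

Lemma size_take_le i v : (i <= size v)%N -> size (take i v) = i.
Proof. by rewrite size_take; case: ltngtP => // ->. Qed.

Lemma take_eq_prefix i u v : (i <= size v)%N -> (take i v == u) = (prefix u v && (i == size u)).
Proof.
move=> iv; apply/eqP/andP => [<-|[/prefixP[w ->] /eqP ->]]; last by rewrite take_size_cat.
by rewrite size_take_le//; split => //; apply/prefixP; exists (drop i v); rewrite cat_take_drop.
Qed.

Lemma conv_delta u x v : conv (fun w => (w == u)%:R) x v = shift_fun u x v.
Proof.
rewrite /shift_fun /conv; case: ifPn => uv.
  have us : (size u < (size v).+1)%N by rewrite ltnS; exact: size_prefix.
  rewrite (bigD1 (Ordinal us)) //= take_eq_prefix// uv eqxx mul1r big1 ?addr0//.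
  move=> [i iv] /= /eqP iu; rewrite take_eq_prefix// uv.
  by case: eqP => [ui|_]; rewrite ?mul0r//; case: iu; apply: val_inj.
by apply: big1 => -[i iv] _; rewrite /= take_eq_prefix// (negbTE uv) mul0r.
Qed.

End FreeConvolution.

Section Symbols.
Variables (R : realType) (d : nat).
Local Notation W := (word d).
Local Notation H := (ell2 R (word d)).
Implicit Types (A B : bop R (word d)) (x : H) (u v w : W).

(** The Fourier coefficients: A is formally the sum of symbol A w L_w. *)
Definition symbol A : H := A (xi R [::]).
Arguments symbol : simpl never.

Lemma symbol_Lop u v : symbol (Lop R u) v = (v == u)%:R.
Proof. by rewrite /symbol Lop_xi cats0. Qed.

Definition is_convolver A := forall x v, A x v = conv (symbol A) x v.

Lemma wot_coord_continuous x v :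
  continuous ((fun A => A x v) : wot R (word d) -> R[i]^o).
Proof.
by under eq_fun do rewrite -inner_xi; exact: wot_continuous.
Qed.

Lemma wot_conv_continuous x v :
  continuous ((fun A => conv (symbol A) x v) : wot R (word d) -> R[i]^o).
Proof.
apply: (@continuous_big R[i]^o) => [|i _]; first exact: add_continuous.
move=> A; apply: (@cvgMr_tmp R[i]); first exact: nbhs_filter.
exact: wot_coord_continuous.
Qed.

(** Both sides of the defining equation are continuous in A for the weak operator
    topology, since the convolution at v is a finite sum; products are handled
    by associativity. *)
Lemma is_convolver_algebra : unital_wot_subalgebra is_convolver.
Proof.
have e0E u : xi R ([::] : W) u = (u == [::])%:R by rewrite xiE.
split.
- split=> [x v|a A B cA cB x v].
    by rewrite [LHS]/= /conv big1 // => i _; exact: mul0r.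
  by rewrite bopDE bopZE ell2DE ell2ZE cA cB -convZl -convDl.
- move=> x v; rewrite /conv (_ : \sum_(i < _) _ = conv (fun w : W => (w == [::])%:R) x v) //.
  by rewrite conv_delta /shift_fun prefix0s drop0.
- move=> A B cA cB x v.
  rewrite bopME cA (_ : (B x : W -> R[i]) = conv (symbol B) x); last exact/funext/cB.
  rewrite convA; apply: eq_conv => i _; congr (_ * _).
  by rewrite /symbol bopME cA.
- rewrite (_ : is_convolver = \bigcap_x \bigcap_v
     ((fun A : wot R (word d) => A x v - conv (symbol A) x v : R[i]^o) @^-1` [set 0])).
    apply: closed_bigI => x _; apply: closed_bigI => v _.
    apply: closed_comp; last first.
      exact/(@accessible_closed_set1 R[i]^o)/hausdorff_accessible/norm_hausdorff.
    move=> A _; apply: cvgB; first exact: nbhs_filter.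
      exact: wot_coord_continuous.
    exact: wot_conv_continuous.
  apply/seteqP; split=> [A cA x _ v _|A cA x v]; first by rewrite /= cA subrr.
  by apply/eqP; rewrite -subr_eq0; apply/eqP; exact: (cA x Logic.I v Logic.I).
Qed.

Lemma Lop_convolver u : is_convolver (Lop R u).
Proof.
move=> x v; rewrite -[LHS]/(shift_fun u x v) -conv_delta.
by apply: eq_conv => i _; rewrite symbol_Lop.
Qed.

(** The convolution operators form a weak-operator closed algebra that contains
    the generators L_w. *)
Lemma Lalg_convolver A : Lalg R d A -> is_convolver A.
Proof.
apply: smallest_sub; first exact: is_convolver_algebra.
by move=> _ [u _ <-]; exact: Lop_convolver.
Qed.

Lemma Lalg_algebra : unital_wot_subalgebra (Lalg R d).
Proof.
split.
- split; first by move=> M [[[M0 _]]].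
  by move=> a A B AL BL M MC; case: (MC) => [[[_ MD] _ _ _] _]; apply: MD; [exact: AL|exact: BL].
- by move=> M [[]].
- by move=> A B AL BL M MC; case: (MC) => [[_ _ MM _] _]; apply: MM; [exact: AL|exact: BL].
- by apply: closed_bigI => M [[]].
Qed.

Lemma Lalg_subspace : Defs.subspace (Lalg R d). Proof. by case: Lalg_algebra. Qed.

Lemma Lalg_mul A B : Lalg R d A -> Lalg R d B -> Lalg R d (A * B).
Proof. by case: Lalg_algebra => _ _ + _; apply. Qed.

Lemma symbol_inj A B : Lalg R d A -> Lalg R d B -> symbol A = symbol B -> A = B.
Proof.
move=> /Lalg_convolver cA /Lalg_convolver cB AB.
by apply: bop_ext => x; apply: ell2_ext => v; rewrite cA cB AB.
Qed.

Lemma Lop_cat u v : Lop R (u ++ v) = Lop R u * Lop R v.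
Proof.
apply: symbol_inj; [exact: Lop_Lalg|by apply: Lalg_mul; exact: Lop_Lalg|].
by rewrite /symbol bopME !Lop_xi !cats0.
Qed.

End Symbols.
Arguments symbol {R d} A : simpl never.

(** * Truncation of Fourier series and homogeneous ideals *)

Section Polynomials.
Variables (R : realType) (d : nat).
Local Notation W := (word d).
Local Notation L := (Lalg R d).
Implicit Types (A B : bop R (word d)) (u v w : W) (n : nat).

Definition npoly (c : W -> R[i]) n : bop R (word d) :=
  \sum_(w : n.-bseq 'I_d) c w *: Lop R w.

Lemma Lalg_sum (T : Type) (s : seq T) (c : T -> R[i]) (A : T -> bop R (word d)) :
  (forall t, L (A t)) -> L (\sum_(t <- s) c t *: A t).
Proof.
move=> LA; elim: s => [|t s IHs]; first by rewrite big_nil; exact: (proj1 (Lalg_subspace R d)).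
by rewrite big_cons; apply: (proj2 (Lalg_subspace R d)); [exact: LA|exact: IHs].
Qed.

Lemma npoly_Lalg c n : L (npoly c n).
Proof. by apply: Lalg_sum => w; exact: Lop_Lalg. Qed.

Lemma symbol_sum (T : Type) (s : seq T) (c : T -> R[i]) (A : T -> bop R (word d)) v :
  symbol (\sum_(t <- s) c t *: A t) v = \sum_(t <- s) c t * symbol (A t) v.
Proof. by rewrite /symbol bop_sumE ell2_sumE. Qed.

Lemma symbol_npoly c n v : symbol (npoly c n) v = if (size v <= n)%N then c v else 0.
Proof.
rewrite symbol_sum; under eq_bigr do rewrite symbol_Lop.
case: ifPn => vn.
  rewrite (bigD1 (Bseq vn)) //= eqxx mulr1 big1 ?addr0// => w wv.
  case: eqP => [vw|]; rewrite ?mulr0//.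
  by case/eqP: wv; apply: val_inj.
apply: big1 => w _; case: eqP => [vw|]; rewrite ?mulr0//.
by move: vn; rewrite vw size_bseq.
Qed.

Definition trunc n A := npoly (symbol A) n.

Lemma symbol_trunc n A v : symbol (trunc n A) v = if (size v <= n)%N then symbol A v else 0.
Proof. exact: symbol_npoly. Qed.

Lemma truncP n a A B : trunc n (a *: A + B) = a *: trunc n A + trunc n B.
Proof.
rewrite /trunc /npoly scaler_sumr -big_split; apply: eq_bigr => w _ /=.
by rewrite scalerA -scalerDl.
Qed.

Lemma trunc_sum n (T : Type) (s : seq T) (c : T -> R[i]) (A : T -> bop R (word d)) :
  trunc n (\sum_(t <- s) c t *: A t) = \sum_(t <- s) c t *: trunc n (A t).
Proof.
elim: s => [|t s IHs]; last by rewrite !big_cons truncP IHs.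
by rewrite !big_nil /trunc /npoly big1 // => w _; rewrite scale0r.
Qed.

Lemma symbolM A B v : L A -> symbol (A * B) v = conv (symbol A) (symbol B) v.
Proof. by move=> LA; rewrite -Lalg_convolver. Qed.

(** The coefficients of a product of degree at most n only involve those of the factors. *)
Lemma trunc_mul n A B : L A -> L B ->
  trunc n (A * B) = trunc n (trunc n A * B) /\
  trunc n (A * B) = trunc n (A * trunc n B).
Proof.
move=> LA LB; have tL C : L (trunc n C) by exact: npoly_Lalg.
split; apply: symbol_inj => //; apply: ell2_ext => v; rewrite !symbol_trunc.
  case: ifP => // vn; rewrite !symbolM//; apply: eq_conv => i iv.
  by rewrite symbol_trunc size_take_le // (leq_trans iv vn).
case: ifP => // vn; rewrite !symbolM//; apply: eq_conv => i iv.
by rewrite symbol_trunc size_drop (leq_trans (leq_subr _ _) vn).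
Qed.

Lemma trunc_Lop_mull n u B : (size u <= n)%N -> L B ->
  trunc n (Lop R u * B) = Lop R u * trunc (n - size u) B.
Proof.
move=> un LB; have LuL := @Lop_Lalg R d u.
have tL k C : L (trunc k C) by exact: npoly_Lalg.
apply: symbol_inj => //; first exact: Lalg_mul.
apply: ell2_ext => v; rewrite symbol_trunc.
rewrite -[RHS]/(shift_fun u (symbol (trunc (n - size u) B)) v).
rewrite -[symbol (_ * _) v]/(shift_fun u (symbol B) v) /shift_fun.
case: prefixP => [[w ->]|_]; last by case: ifP.
by rewrite symbol_trunc drop_size_cat// size_cat leq_subRL.
Qed.

Lemma trunc_Lop_mulr n u B : (size u <= n)%N -> L B ->
  trunc n (B * Lop R u) = trunc (n - size u) B * Lop R u.
Proof.
move=> un LB; have LuL := @Lop_Lalg R d u.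
have tL k C : L (trunc k C) by exact: npoly_Lalg.
apply: symbol_inj => //; first exact: Lalg_mul.
apply: ell2_ext => v; rewrite symbol_trunc !symbolM//.
have E i : (i <= size v)%N -> drop i v == u -> size v = (i + size u)%N.
  by move=> iv /eqP <-; rewrite size_drop subnKC.
case: ifPn => vn.
  apply: eq_conv => i iv; rewrite symbol_Lop symbol_trunc size_take_le//.
  case: eqP => [/eqP/(E i iv) vi|_]; last by rewrite !mulr0.
  by rewrite leq_subRL// addnC -vi vn.
apply/esym/big1 => j _; have iv : (j <= size v)%N by rewrite -ltnS.
rewrite symbol_Lop symbol_trunc size_take_le//; move: {j} (j : nat) iv => i iv.
case: eqP => [/eqP/(E i iv) vi|_]; last by rewrite mulr0.
by rewrite leq_subRL// addnC -vi (negbTE vn) mul0r.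
Qed.

Lemma trunc_continuous n : continuous (trunc n : wot R (word d) -> wot R (word d)).
Proof.
move=> A; have FF : Filter (nbhs (A : wot R (word d))) by exact: nbhs_filter.
apply: (@wot_cvg _ _ _ _ (fmap_filter _ FF)) => p q.
suff : continuous (fun B : wot R (word d) => inner (trunc n B p) q : R[i]^o) by apply.
rewrite (_ : (fun B => _) = (fun B : wot R (word d) =>
  \sum_(w : n.-bseq 'I_d) symbol B w * inner (Lop R w p) q : R[i]^o)); last first.
  apply/funext => B; rewrite /trunc /npoly.
  by rewrite bop_sumE inner_suml; apply: eq_bigr => w _; rewrite bopZE innerZl.
apply: (@continuous_big R[i]^o) => [|w _]; first exact: add_continuous.
move=> B; apply: (@cvgMr_tmp R[i]); first exact: nbhs_filter.
exact: wot_coord_continuous.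
Qed.

End Polynomials.

Section HomogeneousIdeal.
Variables (R : realType) (d : nat) (J : set (bop R (word d))).
Local Notation L := (Lalg R d).
Hypotheses (J_ideal : wot_ideal J) (J_hom : homogeneous_ideal J).

Lemma ideal_sub A : J A -> L A. Proof. by case: J_ideal => + _ _ _; apply. Qed.

Lemma ideal_subspace : Defs.subspace J. Proof. by case: J_ideal. Qed.

Lemma idealMl A B : L A -> J B -> J (A * B).
Proof. by case: J_ideal => _ _ JM _ LA JB; case: (JM A B LA JB). Qed.

Lemma idealMr A B : L A -> J B -> J (B * A).
Proof. by case: J_ideal => _ _ JM _ LA JB; case: (JM A B LA JB). Qed.

Lemma idealP a A B : J A -> J B -> J (a *: A + B).
Proof. exact: (proj2 ideal_subspace). Qed.

Lemma ideal0 : J 0. Proof. exact: (proj1 ideal_subspace). Qed.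

Lemma ideal_sum (T : Type) (s : seq T) (P : pred T) (c : T -> R[i])
    (A : T -> bop R (word d)) :
  (forall t, P t -> J (A t)) -> J (\sum_(t <- s | P t) c t *: A t).
Proof.
move=> JA; elim: s => [|t s IHs]; first by rewrite big_nil; exact: ideal0.
by rewrite big_cons; case: ifP => // Pt; apply: idealP => //; exact: JA.
Qed.

(** The truncation of a homogeneous polynomial is the polynomial itself or 0. *)
Lemma homogeneous_trunc n G : homogeneous_poly G -> J G -> J (trunc n G).
Proof.
move=> [m Gm] JG.
have [LG Gv] : L G /\ forall v, size v != m -> symbol G v = 0.
  apply: (Gm [set A | L A /\ forall v, size v != m -> symbol A v = 0]); split.
    split.
      by split=> [|v _]; [exact: (proj1 (Lalg_subspace R d))|].
    move=> a A B [LA A0] [LB B0]; split.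
      by apply: (proj2 (Lalg_subspace R d)).
    move=> v vm; rewrite -[LHS]/(a * symbol A v + symbol B v).
    by rewrite A0// B0// mulr0 addr0.
  move=> _ [w wm <-]; split; first exact: Lop_Lalg.
  by move=> v vm; rewrite symbol_Lop; case: eqP => // vw; rewrite vw wm eqxx in vm.
have [mn|nm] := leqP m n.
  rewrite (_ : trunc n G = G) //; apply: symbol_inj => //; first exact: npoly_Lalg.
  apply: ell2_ext => v; rewrite symbol_trunc; case: leqP => // nv.
  by rewrite Gv// gtn_eqF// (leq_ltn_trans mn).
rewrite (_ : trunc n G = 0); first exact: ideal0.
apply: symbol_inj; [exact: npoly_Lalg|exact: (proj1 (Lalg_subspace R d))|].
apply: ell2_ext => v; rewrite symbol_trunc; case: leqP => // vn.
by rewrite Gv// ltn_eqF// (leq_ltn_trans vn).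
Qed.

(** The elements of J with all truncations in J form a closed ideal. For a
    product, truncate the multiplier from L first: it becomes a polynomial, and
    multiplication by L_w only shifts the degree of truncation. *)
Lemma ideal_trunc n A : J A -> J (trunc n A).
Proof.
move=> JA; pose K := [set A | J A /\ forall n, J (trunc n A)].
suff JK : J `<=` K by have [_] := JK _ JA; apply.
have [G Ghom JG] := J_hom; rewrite [X in X `<=` _]JG.
have GJ : G `<=` J by rewrite JG; exact: sub_gen_smallest.
apply: smallest_sub; last by move=> B GB; split=> [|k]; [|apply: homogeneous_trunc]; auto.
split.
- by move=> B [/ideal_sub].
- split.
    split=> [|k]; first exact: ideal0.
    rewrite (_ : trunc k 0 = 0); first exact: ideal0.
    by rewrite /trunc /npoly big1// => w _; exact: scale0r.
  move=> a B C [JB Bk] [JC Ck]; split=> [|k]; first exact: idealP.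
  by rewrite truncP; exact: idealP.
- move=> B C LB [JC Ck]; have LC := ideal_sub JC.
  have LL := @Lop_Lalg R d.
  split; split=> [|k]; first exact: idealMl.
  + have [-> _] := trunc_mul k LB LC.
    have -> : trunc k (trunc k B * C) =
        \sum_(w : k.-bseq 'I_d) symbol B w *: trunc k (Lop R w * C).
      rewrite -trunc_sum; congr trunc; rewrite /trunc /npoly mulr_suml.
      by apply: eq_bigr => w _; rewrite bop_scaleAl.
    apply: ideal_sum => w _.
    rewrite trunc_Lop_mull ?size_bseq//; exact: idealMl.
  + exact: idealMr.
  + have [_ ->] := trunc_mul k LC LB.
    have -> : trunc k (C * trunc k B) =
        \sum_(w : k.-bseq 'I_d) symbol B w *: trunc k (C * Lop R w).
      rewrite -trunc_sum; congr trunc; rewrite /trunc /npoly mulr_sumr.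
      by apply: eq_bigr => w _; rewrite bop_scaleAr.
    apply: ideal_sum => w _.
    rewrite trunc_Lop_mulr ?size_bseq//; exact: idealMr.
- rewrite (_ : K = J `&` \bigcap_k ((trunc k : wot R (word d) -> wot R (word d)) @^-1` J)).
    have [_ _ _ Jc] := J_ideal; apply: closedI => //.
    by apply: closed_bigI => k _; apply: closed_comp => // B _; exact: trunc_continuous.
  by apply/seteqP; split=> B [JB Bk]; split=> // k; [move=> _; exact: Bk|exact: (Bk k Logic.I)].
Qed.

End HomogeneousIdeal.

(** * Summability kernels and weak-star density of polynomials *)

Section Fejer.
Variables (R : realType) (d : nat).
Local Notation W := (word d).
Local Notation L := (Lalg R d).
Implicit Types (A : bop R (word d)) (x : ell2 R (word d)) (v w : W).

Definition fejer n A := npoly (fun w => ((n - size w)%:R / n%:R) * symbol A w) n.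

Lemma fejerE n A x v :
  fejer n A x v = conv (fun w => ((n - size w)%:R / n%:R) * symbol A w) x v.
Proof.
rewrite (Lalg_convolver (npoly_Lalg _ _)); apply: eq_conv => i iv.
rewrite symbol_npoly; case: ifPn => //; rewrite -ltnNge => /ltnW.
by rewrite -subn_eq0 => /eqP ->; rewrite mulr0n !mul0r.
Qed.

(** The Fejer mean of A is the average of the compressions of A to n consecutive
    degrees; this is the set of words with degree in such a window ending at m. *)
Definition window n m : pred W := fun u => (size u <= m < size u + n)%N.

(** For a prefix of length i, exactly n - i of the n windows containing the
    degree of v also contain the degree of the corresponding suffix. *)
Lemma fejer_window n A x v : L A -> (0 < n)%N ->
  n%:R * fejer n A x v = \sum_(j < n) A (mask (window n (size v + j)) x) v.
Proof.
move=> LA n0; under eq_bigr do rewrite (Lalg_convolver LA).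
rewrite fejerE /conv exchange_big big_distrr /=; apply: eq_bigr => -[i iv] _ /=.
rewrite ltnS in iv.
rewrite (eq_bigr (fun j : 'I_n => if (j < n - i)%N then symbol A (take i v) * x (drop i v) else 0)).
  rewrite -big_mkcond (big_ord_narrow (leq_subr i n)) sumr_const card_ord.
  have nz : n%:R != 0 :> R[i] by rewrite pnatr_eq0 -lt0n.
  by rewrite size_take_le// -[RHS]mulr_natl; field.
move=> j _; rewrite /= /mask_fun /window size_drop.
have -> : (size v - i <= size v + j < size v - i + n)%N = (j < n - i)%N.

  clear -iv; move: (size v) (nat_of_ord j) iv => s k iv; lia.
by case: ifP => // _; rewrite mulr0.
Qed.

Lemma esum_window n (u : W) (c : R) : 0 <= c ->
  (\esum_(m in [set: nat]) (if window n m u then c else 0)%:E = (n%:R * c)%:E)%E.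
Proof.
move=> c0; rewrite (@esum_inj _ _ _ (fun j : 'I_n => (size u + j)%N)).
- rewrite esum_fset; [|exact: finite_finset|by move=> j _; rewrite lee_fin; case: ifP].
  rewrite fsbig_finite; last exact: finite_finset.
  rewrite (eq_bigr (fun=> c%:E)); last first.
    by move=> j _; rewrite /window leq_addr ltn_add2l ltn_ord.
  rewrite sumEFin (perm_big (enum 'I_n)) /=.
    by rewrite big_enum sumr_const card_ord mulr_natl.
  apply: uniq_perm => [||j]; [exact: fset_uniq|exact: enum_uniq|].
  rewrite mem_enum in_fset_set; last exact: finite_finset.
  by rewrite mem_set.
- by move=> i j /addnI /val_inj.
- move=> m mN; case: ifP => // /andP[um mun]; case: mN.
  have mu : (m - size u < n)%N by rewrite ltn_subLR.
  by exists (Ordinal mu) => //=; rewrite subnKC.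
Qed.

(** Cauchy-Schwarz over the n windows that contain the degree of v, then
    exchange of the sums over v and over the windows, each word being in n of
    them. *)
Lemma fejer_bound n A (B : R) : L A -> (0 < n)%N -> 0 <= B ->
  (forall x, (sqnorm (A x) <= B%:E * sqnorm x)%E) ->
  forall x, (sqnorm (fejer n A x) <= B%:E * sqnorm x)%E.
Proof.
move=> LA n0 B0 AB x; pose g m v := abs2 (A (mask (window n m) x) v).
have nR : 0 < n%:R :> R by rewrite ltr0n.
have g0 m v : 0 <= g m v by exact: abs2_ge0.
have pt v : ((abs2 (fejer n A x v))%:E <= (n%:R^-1)%:E * \esum_(m in [set: nat]) (g m v)%:E)%E.
  apply: le_trans (_ : (n%:R^-1)%:E * (\sum_(j < n) g (size v + j)%N v)%:E <= _)%E; last first.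
    apply: lee_wpmul2l; first by rewrite lee_fin invr_ge0 ler0n.
    rewrite -(big_mkord xpredT (fun j => g (size v + j)%N v)).
    rewrite -(big_map (addn (size v)) xpredT (fun m => g m v)).
    apply: (@seq_le_esum _ _ _ (fun m => g m v)) => //.
    by rewrite map_inj_uniq ?iota_uniq//; exact: addnI.
  rewrite -EFinM lee_fin -(ler_pM2l nR) -(ler_pM2l nR) mulrA [X in _ <= _ * X]mulrA.
  rewrite mulfV ?gt_eqF// mul1r -expr2.
  apply: le_trans (abs2_sum n (fun j => A (mask (window n (size v + j)) x) v)).
  rewrite -fejer_window// abs2M; apply: ler_wpM2r; first exact: abs2_ge0.
  by rewrite -abs2_real rmorph_nat.
apply: le_trans (le_esum (fun v _ => pt v)) _.
rewrite esumZl ?invr_ge0 ?ler0n//; last by move=> v; apply: esum_ge0 => m _; rewrite lee_fin.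
rewrite esum_swap//; last by move=> v m; rewrite lee_fin.
apply: (@le_trans _ _ ((n%:R^-1)%:E *
    \esum_(m in [set: nat]) (B%:E * sqnorm (mask (window n m) x)))%E).
  apply: lee_wpmul2l; first by rewrite lee_fin invr_ge0 ler0n.
  by apply: le_esum => m _; exact: AB.
rewrite esumZl//; last by move=> m; exact: sqnorm_ge0.
rewrite /sqnorm esum_swap; last by move=> m u; rewrite lee_fin abs2_ge0.
rewrite (eq_esum (b := fun u => (n%:R%:E * (abs2 (x u))%:E)%E)); last first.
  move=> u _; rewrite -EFinM -(esum_window n u (abs2_ge0 (x u))); apply: eq_esum => m _.
  by rewrite maskE; case: ifP => //; rewrite abs20.
rewrite esumZl ?ler0n//; last by move=> u; rewrite lee_fin abs2_ge0.
by rewrite [leLHS]muleCA [X in (_ * X <= _)%E]muleA -EFinM mulVf ?gt_eqF// mul1e.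
Qed.

(** The weights 2 (2p - i)_+ / 2p - (p - i)_+ / p are equal to 1 for i <= p, which
    keeps the low coefficients and the uniform bound of the Fejer means. *)
Definition vallee_poussin p A := 2 *: fejer (2 * p) A - fejer p A.

Lemma vallee_poussin_low p A x v : L A -> (0 < p)%N -> (size v < p)%N ->
  vallee_poussin p A x v = A x v.
Proof.
move=> LA p0 vp; rewrite /vallee_poussin bopBE bopZE ell2BE ell2ZE !fejerE (Lalg_convolver LA).
rewrite -convZl -mulN1r -convZl -convDl; apply: eq_conv => i iv.
rewrite size_take_le//; congr (_ * _).
have ip : (i <= p)%N by exact: leq_trans iv (ltnW vp).
have nz : p%:R != 0 :> R[i] by rewrite pnatr_eq0 -lt0n.
rewrite !natrB// ?natrM; last by rewrite mul2n -addnn (leq_trans ip)// leq_addr.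
by field.
Qed.

Lemma vallee_poussin_bound p A (B : R) : L A -> (0 < p)%N -> 0 <= B ->
  (forall x, (sqnorm (A x) <= B%:E * sqnorm x)%E) ->
  forall x, (sqnorm ((A - vallee_poussin p A : bop R (word d))%R x) <= (22 * B)%:E * sqnorm x)%E.
Proof.
move=> LA p0 B0 AB x.
have w (r : R) (u v : \bar R) : 0 <= r -> (u <= v -> r%:E * u <= r%:E * v)%E.
  by move=> r0; apply: lee_wpmul2l; rewrite lee_fin.
have xf : sqnorm x \is a fin_num by rewrite ge0_fin_numE ?ell2_fin ?sqnorm_ge0.
have p20 : (0 < 2 * p)%N by rewrite muln_gt0.
have := AB x; have := fejer_bound LA p0 B0 AB x; have := fejer_bound LA p20 B0 AB x.
have E : (A - vallee_poussin p A : bop R (word d)) x =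
   A x + ((- 2) *: fejer (2 * p) A x + fejer p A x).
  by rewrite bopBE /vallee_poussin bopBE bopZE opprB scaleNr [X in _ = _ + X]addrC.
rewrite E => f2 f1 f0.
apply: le_trans (sqnormD _ _) _.
have h1 : (sqnorm ((-2) *: fejer (2 * p) A x : ell2 R (word d))%R <= 4%:E * (B%:E * sqnorm x))%E.
  rewrite sqnormZ (_ : abs2 (-2) = 4); first exact: w.
  have -> : (- 2 : R[i]) = (- 2)%:C by rewrite rmorphN rmorph_nat.
  by rewrite abs2_real; ring.
have n2 : 0 <= 2 :> R by [].
have h2 := le_trans (sqnormD _ _) (leeD (w _ _ _ n2 h1) (w _ _ _ n2 f1)).
apply: le_trans (leeD (w _ _ _ n2 f0) (w _ _ _ n2 h2)) _.
rewrite -(fineK xf). rewrite -!(EFinM, EFinD) lee_fin.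
by rewrite le_eqVlt; apply/orP; left; apply/eqP; ring.
Qed.

(** omega X Y A = omega X Y (A - V) for the polynomial V = vallee_poussin p A.
    As A - V raises the degree by at least p, only the tail of Y beyond degree p
    contributes, and A - V is bounded independently of p. *)
Lemma omega_density (X Y : ell2 R (word d * nat)%type) :
  (forall w, omega X Y (Lop R w) = 0) -> forall A, L A -> omega X Y A = 0.
Proof.
move=> XY0 A LA; have [_ [B B0 AB]] := bopP A.
have poly0 c n : omega X Y (npoly c n) = 0.
  by rewrite /npoly omega_sum big1 // => w _; rewrite XY0 mulr0.
have Xf : sqnorm X \is a fin_num by rewrite ge0_fin_numE ?ell2_fin ?sqnorm_ge0.
(* 22 B bounds A - V; the added 1 makes a positive. *)
pose a := 22 * B * fine (sqnorm X) + 1.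
have a0 : 0 < a.
  by rewrite ltr_wpDl ?ltr01// !mulr_ge0// fine_ge0// sqnorm_ge0.
apply/eqP; rewrite -(normr_eq0 (omega X Y A)) normcE eq_complex /= eqxx andbT.
rewrite eq_le normc_ge0 andbT; apply/ler_addgt0Pr => e e0; rewrite add0r.
pose deg (i : word d * nat) := size i.1.
have ampE (D : bop R (word d)) :
    (forall x, (sqnorm (D x) <= (22 * B)%:E * sqnorm x)%E) ->
    (sqnorm (tensl_fun D X) <= a%:E)%E.
  move=> DB; apply: le_trans (sqnorm_tensl _ _ DB) _; first by rewrite mulr_ge0.
  by rewrite -(fineK Xf) -EFinM lee_fin lerDl.
have [q q0 qP] : exists2 q : R, 0 < q & forall D : bop R (word d),
    (forall x, (sqnorm (D x) <= (22 * B)%:E * sqnorm x)%E) ->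
    forall Z : ell2 R (word d * nat)%type, (sqnorm Z <= q%:E)%E ->
    normc (inner (tensl_fun D X) Z) <= e.
  have [q q0 qP] := inner_small (word d * nat)%type a0 e0.
  by exists q => // D /ampE Da Z; apply: qP.
(* The cut-off p + 1 is positive, as [vallee_poussin_bound] requires. *)
have [p pY] := sqnorm_tail Y deg q0.
have p1Y : (sqnorm (mask (fun i => (p.+1 <= deg i)%N) Y) <= q%:E)%E.
  apply: le_trans pY; apply: le_esum => i _; rewrite lee_fin !maskE.
  have [pi|_] := boolP (p.+1 <= deg i)%N; first by rewrite (ltnW pi).
  by rewrite abs20 abs2_ge0.
pose D : bop R (word d) := A - vallee_poussin p.+1 A.
have -> : omega X Y A = omega X Y D.
  have -> : D = (-1) *: (2 *: fejer (2 * p.+1) A + ((-1) *: fejer p.+1 A + 0)) + A.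
    by rewrite addr0 !scaleN1r addrC.
  by rewrite !omegaP omega0 /fejer !poly0 !(mulr0, addr0, add0r).
rewrite /omega -(@inner_mask _ _ (fun i => (p.+1 <= deg i)%N)).
  by apply: qP => // x; exact: vallee_poussin_bound.
move=> [v k]; rewrite -ltnNge => vp.
have -> : tensl_fun D X (v, k) = D (ell2_col X k) v by [].
by rewrite /D bopBE ell2BE vallee_poussin_low ?subrr.
Qed.

End Fejer.

(** * The orthogonal complement of the ideal *)

Section Separation.
Variables (K : fieldType) (k : nat) (S : 'rV[K]_k -> Prop).
Hypotheses (S0 : S 0) (SP : forall a u v, S u -> S v -> S (a *: u + v)).

(** A matrix of maximal rank among those with row space in S. *)
Lemma row_space_exists : exists B : 'M[K]_k, forall u : 'rV_k, (u <= B)%MS <-> S u.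
Proof.
pose Q r := `[< exists B : 'M[K]_k, (forall u : 'rV_k, (u <= B)%MS -> S u) /\ \rank B = r >].
have Q0 : exists r, Q r.
  exists 0%N; apply/asboolP; exists 0; split; last exact: mxrank0.
  by move=> u; rewrite submx0 => /eqP ->.
have Qk r : Q r -> (r <= k)%N by move=> /asboolP[B [_ <-]]; exact: rank_leq_row.
case: (ex_maxnP Q0 Qk) => r /asboolP[B [BS rB]] rmax.
exists B => u; split; first exact: BS.
move=> Su; apply/negPn/negP => uB.
have : Q (\rank (B + u)%MS).
  apply/asboolP; exists (B + u)%MS; split => // v /sub_addsmxP[[w1 w2] ->].
  have -> : w1 *m B + w2 *m u = (w2 0 0) *: u + w1 *m B.
    by rewrite addrC [w2]mx11_scalar mul_scalar_mx !mxE.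
  by apply: SP => //; apply: BS; exact: submxMl.
move=> /rmax; rewrite -rB leqNgt => /negP; apply; apply: rank_ltmx.
by rewrite /ltmx addsmxSl addsmx_sub negb_and uB orbT.
Qed.

Lemma separating_column (v : 'rV[K]_k) : ~ S v -> exists c : 'cV[K]_k,
  (forall u, S u -> u *m c = 0) /\ v *m c != 0.
Proof.
move=> vS; have [B BP] := row_space_exists.
have : v *m cokermx B != 0 by rewrite -submxE; apply/negP => /BP.
case/matrix0Pn => i [j vj]; exists (col j (cokermx B)); split.
  by move=> u /BP; rewrite submxE => /eqP uB; rewrite colE mulmxA uB mul0mx.
apply/negP => /eqP; rewrite colE mulmxA -colE => /matrixP/(_ i 0).
by rewrite mxE => v0; move: vj; rewrite v0 mxE eqxx.
Qed.

End Separation.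

Section FiniteVectors.
Variables (R : realType) (d : nat).
Local Notation W := (word d).
Local Notation H := (ell2 R (word d)).
Implicit Types (x y : H) (v w : W).

Definition fvec n (c : W -> R[i]) : H := \sum_(w : n.-bseq 'I_d) c w *: xi R (w : W).

Lemma fvecE n c v : fvec n c v = if (size v <= n)%N then c v else 0.
Proof.
rewrite /fvec ell2_sumE; under eq_bigr do rewrite ell2ZE xiE.
case: ifPn => vn.
  rewrite (bigD1 (Bseq vn)) //= eqxx mulr1 big1 ?addr0// => w wv.
  case: eqP => [vw|]; rewrite ?mulr0//.
  by case/eqP: wv; apply: val_inj.
apply: big1 => w _; case: eqP => [vw|]; rewrite ?mulr0//.
by move: vn; rewrite vw size_bseq.
Qed.

Lemma inner_fvec n x (c : W -> R[i]) :
  inner x (fvec n c) = \sum_(w : n.-bseq 'I_d) x w * (c w)^*.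
Proof.
rewrite inner_conj /fvec inner_suml rmorph_sum; apply: eq_bigr => w _.
by rewrite /= -inner_conj innerZr inner_xi mulrC.
Qed.

Lemma inner_approx x y : (forall n, inner x (fvec n y) = 0) -> inner x y = 0.
Proof.
move=> xy; apply/eq0_normc/eqP; rewrite eq_le normc_ge0 andbT.
apply/ler_addgt0Pr => e e0; rewrite add0r.
have xf : sqnorm x \is a fin_num by rewrite ge0_fin_numE ?ell2_fin ?sqnorm_ge0.
have a0 : 0 < fine (sqnorm x) + 1 by rewrite ltr_wpDl// fine_ge0// sqnorm_ge0.
have [b b0 bP] := inner_small W a0 e0.
have [p pP] := sqnorm_tail y size b0.
have -> : y = fvec p y + (y - fvec p y) by rewrite addrC subrK.
rewrite innerDr xy add0r; apply: bP.
  by rewrite -[leLHS](fineK xf) lee_fin lerDl.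
apply: le_trans pP; apply: le_esum => v _; rewrite lee_fin maskE ell2BE fvecE.
have [pv|pv|pv] := ltngtP (size v) p.
- by rewrite subrr abs20.
- by rewrite subr0.
- by rewrite subrr abs20 abs2_ge0.
Qed.

(** Bounded operators are determined by their values on the basis vectors. *)
Lemma bop_approx (A : bop R (word d)) x y :
  (forall w, inner (A (xi R w)) y = 0) -> inner (A x) y = 0.
Proof.
move=> Ay; have [_ [B B0 AB]] := bopP A.
apply/eq0_normc/eqP; rewrite eq_le normc_ge0 andbT.
apply/ler_addgt0Pr => e e0; rewrite add0r.
have yf : sqnorm y \is a fin_num by rewrite ge0_fin_numE ?ell2_fin ?sqnorm_ge0.
have a0 : 0 < fine (sqnorm y) + 1 by rewrite ltr_wpDl// fine_ge0// sqnorm_ge0.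
have [b b0 bP] := inner_small W a0 e0.
have c0 : 0 < b / (B + 1) by rewrite divr_gt0// ltr_wpDl.
have [p pP] := sqnorm_tail x size c0.
have -> : x = fvec p x + (x - fvec p x) by rewrite addrC subrK.
rewrite bop_additive innerDl.
have -> : inner (A (fvec p x)) y = 0.
  rewrite /fvec; elim/big_rec: _ => [|w z _ IHz]; first by rewrite bop_map0 inner0l.
  by rewrite bop_linear innerDl innerZl Ay IHz mulr0 addr0.
rewrite add0r inner_conj normc_conj; apply: bP.
  by rewrite -[leLHS](fineK yf) lee_fin lerDl.
apply: le_trans (AB _) _; apply: le_trans (lee_wpmul2l _ (le_trans _ pP)) _.
- by rewrite lee_fin.
- apply: le_esum => v _; rewrite lee_fin maskE ell2BE fvecE.
  have [pv|pv|pv] := ltngtP (size v) p.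
  + by rewrite subrr abs20.
  + by rewrite subr0.
  + by rewrite subrr abs20 abs2_ge0.
have B1 : 0 < B + 1 by rewrite ltr_wpDl.
rewrite -EFinM lee_fin mulrA ler_pdivrMr// mulrC ler_pM2l//.
by rewrite lerDl.
Qed.

End FiniteVectors.

Section OrthogonalComplement.
Variables (R : realType) (d : nat) (J : set (bop R (word d))).
Local Notation W := (word d).
Local Notation H := (ell2 R (word d)).
Local Notation L := (Lalg R d).
Hypotheses (J_ideal : wot_ideal J) (J_hom : homogeneous_ideal J).
Variable P : bop R (word d).
Hypothesis P_proj : is_orth_proj (Nperp J) P.
Local Notation N := (Nperp J).
Local Notation g w := (compress P (Lop R w)).
Implicit Types (x y : H) (u v w : W).

Lemma innerPl x y : inner (P x) y = inner (P x) (P y).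
Proof.
have [_ yP] := P_proj y; have [Nx _] := P_proj x.
have := yP _ Nx; rewrite innerBl => /eqP; rewrite subr_eq0 => /eqP yx.
by rewrite inner_conj yx -inner_conj.
Qed.

Lemma P_adj x y : inner (P x) y = inner x (P y).
Proof.
rewrite innerPl; have [_ xP] := P_proj x; have [Ny _] := P_proj y.
by have := xP _ Ny; rewrite innerBl => /eqP; rewrite subr_eq0 => /eqP ->.
Qed.

Lemma Nperp_linear a x y : N x -> N y -> N (a *: x + y).
Proof. by move=> Nx Ny A JA; rewrite innerDr innerZr Nx// Ny// mulr0 addr0. Qed.

Lemma P_range x : N (P x). Proof. by case: (P_proj x). Qed.

Lemma P_id x : N x -> P x = x.
Proof.
move=> Nx; apply/eqP; rewrite eq_sym -subr_eq0; apply/eqP/inner_self0.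
apply: (proj2 (P_proj x)).
by rewrite addrC -scaleN1r; apply: Nperp_linear => //; exact: P_range.
Qed.

Lemma P_ideal A : J A -> P * A = 0.
Proof.
move=> JA; apply: bop_ext => x; apply: ell2_ext => v; rewrite bop0E ell20E.
rewrite -[LHS]inner_xi bopME P_adj; apply: bop_approx => w.
have -> : A (xi R w) = (A * Lop R w) (xi R [::]) by rewrite bopME Lop_xi cats0.
apply: P_range; exact: (idealMr J_ideal (@Lop_Lalg R d w) JA).
Qed.

(** The truncation in degree 0 of an element of J is a scalar in J. *)
Lemma vacuum_Nperp : ~ J 1 -> N (xi R [::]).
Proof.
move=> J1 A JA; rewrite inner_xi; apply/eqP/negP => /negP a0; apply: J1.
have LA := ideal_sub J_ideal JA.
have -> : 1 = (symbol A [::])^-1 *: trunc 0 A + 0.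
  rewrite addr0; apply: symbol_inj.
  - by case: (Lalg_algebra R d).
  - have [L0 LD] := Lalg_subspace R d.
    by rewrite -[X in L X]addr0; apply: LD => //; exact: npoly_Lalg.
  apply: ell2_ext => v; rewrite -[LHS]/((v == [::])%:R) -[RHS]/(_^-1 * symbol (trunc 0 A) v).
  rewrite symbol_trunc leqn0 size_eq0; case: eqP => [->|]; rewrite ?mulr0//.
  by rewrite mulVf.
apply: idealP => //; [exact: ideal_trunc|exact: ideal0].
Qed.

(** If a polynomial c of degree at most n is not in J, some vector x supported in
    degree at most n is orthogonal to the polynomials of J of degree at most n
    but not to c. Since J is stable under truncation, x is in N, and it detects
    the compression of c. *)
Lemma compress_poly n c : compress P (npoly c n) = 0 -> J (npoly c n).
Proof.
move=> Pc; have [J1|J1] := pselect (J 1).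
  by rewrite -[npoly c n]mulr1; apply: idealMl => //; exact: npoly_Lalg.
apply: contrapT => Jc.
pose T : finType := n.-bseq 'I_d.
pose r (f : W -> R[i]) : 'rV[R[i]]_#|T| := \row_j f (enum_val j : T).
pose S (u : 'rV[R[i]]_#|T|) := exists2 f, u = r f & J (npoly f n).
have S0 : S 0.
  exists (fun=> 0); first by apply/rowP => j; rewrite !mxE.
  rewrite (_ : npoly _ _ = 0); first exact: ideal0.
  by rewrite /npoly big1 // => w _; rewrite scale0r.
have SP a s1 s2 : S s1 -> S s2 -> S (a *: s1 + s2).
  move=> [f -> Jf] [h -> Jh]; exists (fun w => a * f w + h w).
    by apply/rowP => j; rewrite !mxE.
  rewrite (_ : npoly _ _ = a *: npoly f n + npoly h n); first exact: idealP.
  rewrite /npoly scaler_sumr -big_split; apply: eq_bigr => w _ /=.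
  by rewrite scalerA -scalerDl.
have [|y [yS yc]] := separating_column S0 SP (v := r c).
  move=> [f cf Jf]; apply: Jc; rewrite (_ : npoly c n = npoly f n) //.
  apply: eq_bigr => w _; congr (_ *: _).
  have /rowP/(_ (enum_rank (w : T))) := cf; rewrite !mxE enum_rankK.
  done.
pose x := fvec n (fun w => if insub w is Some t then (y (enum_rank (t : T)) 0)^* else 0).
have innerx f : inner (symbol (npoly f n)) x = (r f *m y) 0 0.
  rewrite inner_fvec mxE (reindex_onto (@enum_rank T) enum_val) /=; last first.
    by move=> j _; exact: enum_valK.
  apply: eq_big => [w|w _]; first by rewrite enum_rankK eqxx.
  by rewrite symbol_npoly size_bseq mxE enum_rankK valK conjCK.
have Nx : N x.
  move=> A JA; rewrite -[A _]/(symbol A).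
  have := innerx (symbol A); rewrite yS; last first.
    by exists (symbol A) => //; exact: ideal_trunc.
  rewrite [RHS]mxE => <-; rewrite !inner_fvec; apply: eq_bigr => w _.
  by rewrite symbol_npoly size_bseq.
move/eqP: yc; apply; apply/matrixP => i j; rewrite !ord1 -innerx mxE.
rewrite -(P_id Nx) /symbol -P_adj -{1}(P_id (vacuum_Nperp J1)).
by rewrite -[P (_ (P _))]/(compress P (npoly c n) (xi R [::])) Pc bop0E inner0l.
Qed.

End OrthogonalComplement.

(** * Word classes and linear relations between them *)

Section Classes.
Variables (R : realType) (d : nat) (J : set (bop R (word d))).
Local Notation W := (word d).
Local Notation H := (ell2 R (word d)).
Local Notation L := (Lalg R d).
Hypotheses (J_ideal : wot_ideal J) (J_hom : homogeneous_ideal J).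
Variable P : bop R (word d).
Hypothesis P_proj : is_orth_proj (Nperp J) P.
Local Notation N := (Nperp J).
Local Notation g w := (compress P (Lop R w)).
Implicit Types (x y : H) (u v w : W).

Lemma compressP a A B : compress P (a *: A + B) = a *: compress P A + compress P B.
Proof. by rewrite /compress mulrDr mulrDl bop_scaleAr bop_scaleAl. Qed.

Lemma compress0 : compress P 0 = 0.
Proof. by rewrite /compress mulr0 mul0r. Qed.

Lemma compress_sum (T : Type) (s : seq T) (c : T -> R[i]) (A : T -> bop R (word d)) :
  compress P (\sum_(t <- s) c t *: A t) = \sum_(t <- s) c t *: compress P (A t).
Proof.
elim: s => [|t s IHs]; first by rewrite !big_nil compress0.
by rewrite !big_cons compressP IHs.
Qed.

Lemma Lquot_subspace : Defs.subspace (Lquot P).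
Proof.
have [L0 LD] := Lalg_subspace R d; split; first by exists 0 => //; exact: compress0.
move=> a _ _ [A LA <-] [B LB <-]; exists (a *: A + B); last exact: compressP.
exact: LD.
Qed.

Lemma compress_ideal A : J A -> compress P A = 0.
Proof. by move=> JA; rewrite /compress (P_ideal J_ideal P_proj JA) mul0r. Qed.

Lemma Lop_npoly u n : (size u <= n)%N -> Lop R u = npoly (fun w => (w == u)%:R) n.
Proof.
move=> un; apply: symbol_inj; [exact: Lop_Lalg|exact: npoly_Lalg|].
apply: ell2_ext => v; rewrite symbol_Lop symbol_npoly; case: ifPn => // vn.
by case: eqP => // vu; rewrite vu un in vn.
Qed.

Lemma npolyB (b c : W -> R[i]) n : npoly b n - npoly c n = npoly (fun w => b w - c w) n.
Proof. by rewrite /npoly -sumrB; apply: eq_bigr => w _; rewrite scalerBl. Qed.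

Lemma class_eqP u v : g u = g v <-> J (Lop R u - Lop R v).
Proof.
have cB : compress P (Lop R u - Lop R v) = g u - g v.
  by rewrite /compress mulrBr mulrBl.
split=> [guv|/compress_ideal]; last by rewrite cB => /eqP; rewrite subr_eq0 => /eqP.
have E := npolyB (fun w => (w == u)%:R) (fun w => (w == v)%:R) (maxn (size u) (size v)).
rewrite -!Lop_npoly ?leq_maxl ?leq_maxr// in E.
by rewrite E; apply: (compress_poly J_ideal J_hom P_proj); rewrite -E cB guv subrr.
Qed.

Lemma class_zeroP u : g u = 0 <-> J (Lop R u).
Proof.
split=> [gu|/compress_ideal //].
rewrite (Lop_npoly (leqnn (size u))).
by apply: (compress_poly J_ideal J_hom P_proj); rewrite -Lop_npoly.
Qed.

Lemma class_mulr u v a : g u = g v -> g (u ++ a) = g (v ++ a).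
Proof.
move=> /class_eqP Juv; apply/class_eqP; rewrite !Lop_cat -mulrBl.
exact: (idealMr J_ideal (@Lop_Lalg R d a) Juv).
Qed.

Lemma class_mulr0 u a : g u = 0 -> g (u ++ a) = 0.
Proof.
move=> /class_zeroP Juv; apply/class_zeroP; rewrite !Lop_cat.
exact: (idealMr J_ideal (@Lop_Lalg R d a) Juv).
Qed.

(** If u is shorter than v, the truncation of L_u - L_v at the length of u is L_u,
    and L_u lies in J as soon as the difference does. *)
Lemma class_size u v : g u = g v -> g u != 0 -> size u = size v.
Proof.
wlog uv : u v / (size u < size v)%N.
  move=> H guv gu; have [uv|uv|//] := ltngtP (size u) (size v); first exact: H.
  by apply/esym/H => //; rewrite -guv.
move=> /class_eqP /(ideal_trunc J_ideal J_hom (size u)) Juv /eqP gu; case: gu.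
apply/class_zeroP; rewrite (_ : Lop R u = trunc (size u) (Lop R u - Lop R v)) //.
apply: symbol_inj; [exact: Lop_Lalg|exact: npoly_Lalg|].
apply: ell2_ext => w; rewrite symbol_trunc.
rewrite -[symbol (_ - _) w]/(symbol (Lop R u) w - symbol (Lop R v) w) !symbol_Lop.
 case: ifPn => wu.
  by case: (w =P v) wu => [->|_ _]; rewrite ?subr0// leqNgt uv.
by case: eqP wu => // ->; rewrite leqnn.
Qed.

Definition class_function x :=
  (forall u v, g u = g v -> x u = x v) /\ (forall u, g u = 0 -> x u = 0).

Lemma Nperp_class_function x : N x -> class_function x.
Proof.
move=> Nx; split=> [u v /class_eqP /Nx|u /class_zeroP /Nx].
  rewrite bopBE !Lop_xi !cats0 innerBl => /eqP; rewrite subr_eq0.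
  by rewrite !(inner_conj x) !inner_xi => /eqP /(can_inj conjCK).
by rewrite Lop_xi cats0 (inner_conj x) inner_xi => /eqP; rewrite conjC_eq0 => /eqP.
Qed.

Variable DeltaJ : Lquot P -> wtensor (Lquot P) (Lquot P).
Hypothesis DeltaJ_comul : comultiplication (piL P) DeltaJ.

Section Relations.
Variable n : nat.
Local Notation T := (n.-bseq 'I_d).
Implicit Types (c h : T -> R[i]) (s t : T).

Definition relation c := \sum_(t : T) c t *: g t = 0.

Lemma relationP a b c : relation b -> relation c -> relation (fun t => a * b t + c t).
Proof.
rewrite /relation => b0 c0; under eq_bigr do rewrite scalerDl -scalerA.
by rewrite big_split /= -scaler_sumr b0 c0 scaler0 addr0.
Qed.

(** The comultiplication is linear and sends g_t to g_t (x) g_t. *)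
Lemma relation_tensor c : relation c -> \sum_(t : T) c t *: tensop (g t) (g t) = 0.
Proof.
have [_ Dlin _ Dpi] := DeltaJ_comul => c0.
have lin (s : seq T) : exists2 z : Lquot P, \val z = \sum_(t <- s) c t *: g t &
    \val (DeltaJ z) = \sum_(t <- s) c t *: tensop (g t) (g t).
  elim: s => [|t s [z zE DzE]].
    have [z z0] := mk_elt (proj1 Lquot_subspace).
    by exists z; rewrite big_nil //; exact: linear_on0 Dlin z0.
  have [y yE] := mk_elt (proj2 Lquot_subspace (c t) _ _ (val_in (piL P t)) (val_in z)).
  exists y; rewrite big_cons; first by rewrite yE zE.
  by rewrite (Dlin _ _ _ _ yE) DzE Dpi.
have [z zE DzE] := lin (index_enum T).
by rewrite -DzE; apply: (linear_on0 Dlin); rewrite zE.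
Qed.

(** A matrix coefficient is applied to the second factor of [relation_tensor]. *)
Lemma relation_coef c x v : relation c -> relation (fun t => c t * g t x v).
Proof.
move=> /relation_tensor c0; apply: bop_ext => y; apply: ell2_ext => u.
have := congr1 (fun A : bop R (W * W)%type => A (tensv y x) (u, v)) c0.
rewrite !bop_sumE !ell2_sumE bop0E ell20E => cE.
rewrite bop0E ell20E -[RHS]cE; apply: eq_bigr => t _.
by rewrite !bopZE !ell2ZE tensopE /= mulrAC mulrA.
Qed.

(** The product over t in l of the functions (g - g_t) / (g_s - g_t), where g
    stands for a matrix coefficient that separates g_t from g_s. *)
Lemma relation_interpolate s (l : seq T) : (forall t, t \in l -> g t != g s) ->
  exists h, [/\ forall t, g t = g s -> h t = 1, forall t, t \in l -> h t = 0 &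
    forall c, relation c -> relation (fun t => h t * c t)].
Proof.
elim: l => [|r l IHl] ls.
  by exists (fun=> 1); split=> // c; under eq_fun do rewrite mul1r.
have [t tl|h [h1 h0 hrel]] := IHl; first by apply: ls; rewrite inE tl orbT.
have [x [v xv]] : exists x v, g r x v != g s x v.
  apply: contrapT => H; have /eqP := ls r (mem_head _ _); apply.
  apply: bop_ext => x; apply: ell2_ext => v; apply/eqP/negPn/negP => xv.
  by apply: H; exists x, v.
pose q := g s x v - g r x v.
have q0 : q != 0 by rewrite subr_eq0 eq_sym.
exists (fun t => (g t x v - g r x v) / q * h t); split.
- by move=> t ts; rewrite h1// mulr1 ts mulfV.
- move=> t; rewrite inE => /orP[/eqP ->|tl]; first by rewrite subrr !mul0r.
  by rewrite h0// mulr0.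
move=> c /hrel hc.
have r0 : relation (fun=> 0) by rewrite /relation big1 // => t _; rewrite scale0r.
have := relationP (- g r x v / q) hc (relationP q^-1 (relation_coef x v hc) r0).
by congr relation; apply/funext => t; ring.
Qed.

Lemma relation_class c s : relation c -> g s != 0 -> \sum_(t : T | g t == g s) c t = 0.
Proof.
move=> crel gs.
have [t|h [h1 h0 hrel]] := @relation_interpolate s [seq t : T <- index_enum T | g t != g s].
  by rewrite mem_filter => /andP[].
have := hrel c crel; rewrite /relation (bigID (fun t : T => g t == g s)) /=.
rewrite [X in _ + X]big1 ?addr0 => [|t ts]; last first.
  by rewrite h0 ?mul0r ?scale0r// mem_filter ts mem_index_enum.
rewrite (eq_bigr (fun t : T => c t *: g s)) => [|t /eqP ts]; last by rewrite h1// mul1r ts.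
by rewrite -scaler_suml => /eqP; rewrite scaler_eq0 (negbTE gs) orbF => /eqP.
Qed.

Lemma relation_class_function c x : relation c -> class_function x ->
  \sum_(t : T) c t * (x t)^* = 0.
Proof.
move=> crel [xeq x0].
(* The sum is grouped by class, each class having the representative rep t. *)
pose rep t := odflt t [pick s : T | g s == g t].
have repE t : g (rep t) = g t.
  by rewrite /rep; case: pickP => //= s /eqP.
have rep_eq s t : g s = g t -> rep s = rep t.
  by rewrite /rep => ->; case: pickP => // /(_ t); rewrite eqxx.
rewrite (partition_big rep xpredT) //=; apply: big1 => r _.
have [[t0 rt0]|nor] := pselect (exists t, rep t = r); last first.
  by apply: big1 => t /eqP tr; case: nor; exists t.
rewrite (eq_bigl (fun t : T => g t == g r)) => [|t]; last first.
  apply/eqP/eqP => [<-|tr]; first by rewrite repE.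
  by rewrite -rt0; apply: rep_eq; rewrite tr -rt0 repE.
rewrite (eq_bigr (fun t : T => c t * (x r)^*)) => [|t /eqP /xeq -> //].
rewrite -mulr_suml; have [/x0 ->|gr] := eqVneq (g r) 0; first by rewrite rmorph0 mulr0.
by rewrite relation_class// mul0r.
Qed.

End Relations.

(** The truncations of A in J are relations between the g_w, and a class function
    is orthogonal to every relation. *)
Lemma class_function_Nperp x : class_function x -> N x.
Proof.
move=> xcl A JA; rewrite -[A _]/(symbol A); apply: inner_approx => n.
rewrite inner_fvec.
apply: (relation_class_function (c := fun t : n.-bseq 'I_d => symbol A t)) => //.
rewrite /relation -compress_sum; apply: compress_ideal.
exact: (ideal_trunc J_ideal J_hom n JA).
Qed.

End Classes.

(** * Products of vector functionals *)

Section TensorData.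
Variables (R : realType) (I : choiceType).
Implicit Types X Y : ell2 R (I * nat)%type.

Definition tens_idx (p : (I * nat) * (I * nat)) : (I * I) * nat :=
  ((p.1.1, p.2.1), choice.pickle (p.1.2, p.2.2)).
Definition tens_inv (p : (I * I) * nat) : option ((I * nat) * (I * nat)) :=
  omap (fun q => ((p.1.1, q.1), (p.1.2, q.2))) (@pickle_inv (nat * nat)%type p.2).

Lemma tens_idxK : pcancel tens_idx tens_inv.
Proof. by move=> [[i k] [j l]]; rewrite /tens_inv /= pickleK_inv. Qed.

Lemma tens_invK : ocancel tens_inv tens_idx.
Proof.
move=> [[i j] m]; rewrite /tens_inv /=; have := @pickle_invK (nat * nat)%type m.
by case: (pickle_inv m) => //= -[k l] /= <-.
Qed.

(** X (x) X' with the two multiplicities coded by one natural number, so that the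
    functional of a tensor product is again indexed by nat. *)
Definition tens X X' : ell2 R ((I * I) * nat)%type :=
  extend tens_idxK tens_invK (tensv X X').

Lemma tens_col X X' k l :
  ell2_col (tens X X') (choice.pickle (k, l)) = tensv (ell2_col X k) (ell2_col X' l).
Proof.
apply: ell2_ext => -[i j].
exact: (extendE tens_idxK tens_invK (tensv X X') ((i, k), (j, l))).
Qed.

Lemma omega_tens X Y X' Y' (A B : bop R I) :
  omega (tens X X') (tens Y Y') (tensop A B) = omega X Y A * omega X' Y' B.
Proof.
rewrite {1}/omega inner_extend /omega !innerE -csum_prod; [|exact: inner_summable..].
congr csum; apply/funext => -[[i k] [j l]].
rewrite -[tensl_fun _ _ _]/(tensop A B (ell2_col (tens X X') (choice.pickle (k, l))) (i, j)).
by rewrite tens_col tensopE /= rmorphM /= mulrACA.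
Qed.

Lemma sqnorm_tensv (J : choiceType) (x : ell2 R I) (y : ell2 R J) :
  sqnorm (tensv x y) = (sqnorm x * sqnorm y)%E.
Proof.
rewrite -[LHS]sqnorm_rows.
rewrite (eq_esum (b := fun i => ((sqnorm y) * (abs2 (x i))%:E)%E)); last first.
  by move=> i _; rewrite muleC -sqnormZ.
have yf : sqnorm y \is a fin_num by rewrite ge0_fin_numE ?ell2_fin ?sqnorm_ge0.
rewrite -{1}(fineK yf) esumZl ?fine_ge0 ?sqnorm_ge0//; last first.
  by move=> i; rewrite lee_fin abs2_ge0.
by rewrite fineK// muleC.
Qed.

Definition single_seq (x : ell2 R I) (k : nat) : ell2 R I := if k == 0%N then x else 0.

Lemma single_fin (x : ell2 R I) :
  (\esum_(k in [set: nat]) sqnorm (single_seq x k) < +oo)%E.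
Proof.
rewrite (_ : esum _ _ = sqnorm x) ?ell2_fin//.
rewrite (@esum_inj _ _ _ (fun _ : 'I_1 => 0%N)) //.
- rewrite (_ : [set: 'I_1] = [set ord0]); last first.
    by apply/seteqP; split=> // i _; apply: val_inj; case: i => -[].
  by rewrite esum_set1 ?sqnorm_ge0.
- by move=> i j _; apply: val_inj; case: i j => -[]// ? [[]].
- move=> k k0; rewrite /single_seq; case: eqP => [kE|_]; last exact: sqnorm0.
  by case: k0; exists ord0.
Qed.

(** A vector functional <A x, y> is the case of one nonzero column. *)
Definition single (x : ell2 R I) : ell2 R (I * nat)%type := stack (single_fin x).

Lemma omega_single (x y : ell2 R I) A : omega (single x) (single y) A = inner (A x) y.
Proof.
rewrite omega_cols; apply: csumE.
have := @has_sum1 R nat 0%N (fun k => inner (A (ell2_col (single x) k)) (ell2_col (single y) k)).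
rewrite !stack_col /=; apply => k k0.
by rewrite !stack_col /single_seq (negbTE k0) inner0r.
Qed.

End TensorData.

Section CommonPrefix.
Variable T : eqType.
Implicit Types u v w p a b : seq T.

Fixpoint lcp u v : seq T * (seq T * seq T) :=
  match u, v with
  | c :: u', c' :: v' =>
      if c == c' then let: (p, ab) := lcp u' v' in (c :: p, ab) else ([::], (u, v))
  | _, _ => ([::], (u, v))
  end.

Definition diverge a b :=
  match a, b with c :: _, c' :: _ => c != c' | _, _ => true end.

Lemma lcpP u v : let: (p, (a, b)) := lcp u v in
  [/\ u = p ++ a, v = p ++ b & diverge a b].
Proof.
elim: u v => [|c u IHu] [|c' v] //=; case: eqP => [<-|/eqP cc'] //.
by have := IHu v; case: lcp => p [a b] [-> -> ?].
Qed.

Lemma lcp_cat p a b : diverge a b -> lcp (p ++ a) (p ++ b) = (p, (a, b)).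
Proof.
move=> ab; elim: p => [|c p IHp] /=; last by rewrite eqxx IHp.
by case: a b ab => [|c a] [|c' b] //= /negbTE ->.
Qed.

(** Just after p the two words disagree, or one of them ends. *)
Lemma prefix_diverge w p a b : diverge a b ->
  prefix w (p ++ a) && prefix w (p ++ b) = prefix w p.
Proof.
move=> ab; elim: p w => [|c p IHp] [|c' w]; rewrite ?prefix0s //=; last first.
  by rewrite -IHp; case: eqP.
case: a b ab => [|x a] [|y b] //= xy; rewrite ?andbF//.
by case: eqP => //= ->; rewrite (negbTE xy) andbF.
Qed.

End CommonPrefix.

Section StarData.
Variables (R : realType) (d : nat).
Local Notation W := (word d).
Implicit Types X Y : ell2 R (word d * nat)%type.

Local Notation code := ((seq 'I_d * seq 'I_d) * (nat * nat))%type.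

Definition star_idx (p : (W * nat) * (W * nat)) : W * nat :=
  ((lcp p.1.1 p.2.1).1, @choice.pickle code ((lcp p.1.1 p.2.1).2, (p.1.2, p.2.2))).
Definition star_inv (p : W * nat) : option ((W * nat) * (W * nat)) :=
  obind (fun q : code => if diverge q.1.1 q.1.2
    then Some ((p.1 ++ q.1.1, q.2.1), (p.1 ++ q.1.2, q.2.2)) else None)
  (@pickle_inv code p.2).

Lemma star_idxK : pcancel star_idx star_inv.
Proof.
move=> [[u k] [v l]]; rewrite /star_inv /star_idx /=; have := lcpP u v.
by case: (lcp u v) => p [a b] [-> -> ab] /=; rewrite pickleK_inv /= ab.
Qed.

Lemma star_invK : ocancel star_inv star_idx.
Proof.
move=> [p m]; rewrite /star_inv /=; have := @pickle_invK code m.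
case: (pickle_inv m) => //= -[[a b] [k l]] /= <-; case: ifP => //= ab.
by rewrite /star_idx /= lcp_cat.
Qed.

(** X (x) X' as a function of the common prefix; the remainders (a, b) and the two
    multiplicities form the new multiplicity. *)
Definition star X X' : ell2 R (word d * nat)%type :=
  extend star_idxK star_invK (tensv X X').

Lemma sqnorm_star X X' : sqnorm (star X X') = (sqnorm X * sqnorm X')%E.
Proof. by rewrite -sqnorm_tensv; exact: (sqnorm_extend star_idxK star_invK). Qed.

Lemma star_col X X' m :
  ell2_col (star X X') m = 0 \/ exists a b k l,
    forall p, ell2_col (star X X') m p = X (p ++ a, k) * X' (p ++ b, l).
Proof.
case Em : (@pickle_inv code m) => [[[a b] [k l]]|]; last first.
  by left; apply: ell2_ext => p /=; rewrite /extend_fun /star_inv /= Em.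
case ab : (diverge a b); last first.
  by left; apply: ell2_ext => p /=; rewrite /extend_fun /star_inv /= Em /= ab.
by right; exists a, b, k, l => p; rewrite /= /extend_fun /star_inv /= Em /= ab.
Qed.

(** L_w (x) L_w prepends w to both words, hence to their longest common prefix and
    leaves the remainders unchanged. *)
Lemma omega_star X Y X' Y' w :
  omega (star X X') (star Y Y') (Lop R w) = omega X Y (Lop R w) * omega X' Y' (Lop R w).
Proof.
rewrite {1}/omega inner_extend /omega !innerE -csum_prod; [|exact: inner_summable..].
congr csum; apply/funext => -[[u k] [v l]].
rewrite -[(tensv Y Y') _]/(Y (u, k) * Y' (v, l)) rmorphM /= mulrACA; congr (_ * _).
have := lcpP u v; rewrite /star_idx /= /shift_fun; case E : (lcp u v) => [p [a b]] [-> -> ab] /=.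
have := prefix_diverge w p ab.
case: (boolP (prefix w p)) => [/prefixP[p' ->] /andP[-> ->]|_].
  rewrite -!catA !drop_size_cat// /extend_fun /star_inv /= pickleK_inv /= ab /=.
  done.
by move=> /negbT; rewrite negb_and => /orP[] /negbTE ->; rewrite ?mul0r ?mulr0.
Qed.

End StarData.

(** * The characters of the predual *)

Section GeometricSeries.
Variable R : realType.

Lemma half_powers_sum (N : nat) : \sum_(n < N) (2^-1 : R) ^+ n.+1 = 1 - 2^-1 ^+ N.
Proof.
elim: N => [|N IHN]; first by rewrite big_ord0 expr0 subrr.
by rewrite big_ord_recr /= IHN exprS; field.
Qed.

Lemma half_powers_esum : (\esum_(n in [set: nat]) ((2^-1 : R) ^+ n.+1)%:E <= 1)%E.
Proof.
have pos n : (0 <= ((2^-1 : R) ^+ n.+1)%:E)%E by rewrite lee_fin exprn_ge0 ?invr_ge0.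
rewrite -nneseries_esumT//; apply: lime_le; first exact: is_cvg_nneseries.
apply: nearW => N; rewrite big_mkord sumEFin half_powers_sum lee_fin gerBl.
by rewrite exprn_ge0 ?invr_ge0.
Qed.

(** The first term is split off and the others are shifted. *)
Lemma geometric_quasi_inverse (c : R[i]) : normc c <= 2^-1 ->
  csum (fun n => c ^+ n.+1) = c + c * csum (fun n => c ^+ n.+1).
Proof.
move=> c2; set f := fun n => c ^+ n.+1.
have normX n : normc (c ^+ n) = normc c ^+ n.
  by elim: n => [|n IHn]; rewrite ?expr0 ?normc1// !exprS normcM IHn.
have fa : abs_summable f.
  apply: le_lt_trans (ltry 1); apply: le_trans half_powers_esum.
  by apply: le_esum => n _; rewrite lee_fin normX lerXn2r ?nnegrE ?normc_ge0 ?invr_ge0.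
apply: csumE.
pose f0 n := if n is 0 then c else 0.
pose f1 n := if n is k.+1 then c * f k else 0.
have s0 : has_sum f0 c by apply: (@has_sum1 R nat 0%N f0); case.
have s1 : has_sum f1 (c * csum f).
  apply: (@has_sum_inj R nat nat succn f1 (c * csum f) succn_inj).
    by case=> [//|n nr]; case: nr; exists n.
  exact: has_sumZ (abs_summable_has_sum fa).
apply: eq_has_sum (has_sumD s0 s1) => -[|n]; rewrite /f0 /f1 /f ?addr0// add0r.
by rewrite -exprS.
Qed.

End GeometricSeries.

Section Characters.
Variables (R : realType) (d : nat) (J : set (bop R (word d))).
Local Notation W := (word d).
Local Notation H := (ell2 R (word d)).
Local Notation D := (ell2 R (word d * nat)%type).
Local Notation L := (Lalg R d).
Hypotheses (J_ideal : wot_ideal J) (J_hom : homogeneous_ideal J).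
Variable P : bop R (word d).
Hypothesis P_proj : is_orth_proj (Nperp J) P.
Variable DeltaJ : Lquot P -> wtensor (Lquot P) (Lquot P).
Hypothesis DeltaJ_comul : comultiplication (piL P) DeltaJ.
Local Notation N := (Nperp J).
Local Notation M := (Lquot P).
Local Notation g w := (compress P (Lop R w)).
Implicit Types (x y : H) (u v w : W) (X Y : D) (phi psi chi : predual (Lquot P)).

Let M_sub := Lquot_subspace P.

Lemma omega_compress X Y A :
  omega X Y (compress P A) = omega (tensl_fun P X) (tensl_fun P Y) A.
Proof.
rewrite !omega_cols; congr csum; apply/funext => k.
have colP (Z : D) : ell2_col (tensl_fun P Z) k = P (ell2_col Z k) by exact: ell2_ext.
by rewrite !colP /compress !bopME (P_adj P_proj).
Qed.

(** The compression P A P is moved onto the vectors, after which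
    [omega_density] applies. *)
Lemma predual_ext (f h : M -> R[i]^o) : predual M f -> predual M h ->
  (forall w, f (piL P w) = h (piL P w)) -> f = h.
Proof.
move=> /(predual_omega M_sub)[X [Y fE]] /(predual_omega M_sub)[X' [Y' hE]] fh.
have [Z [V ZV]] := omegaD X Y (-1 *: X') Y'.
have ZVE A : omega Z V A = omega X Y A - omega X' Y' A.
  by rewrite ZV omegaZl mulN1r.
apply/funext => A; rewrite fE hE; apply/eqP; rewrite -subr_eq0 -ZVE; apply/eqP.
have [B LB <-] := val_in A; rewrite omega_compress.
apply: omega_density LB => w; rewrite -omega_compress ZVE.
by rewrite -(fE (piL P w)) -(hE (piL P w)) fh subrr.
Qed.

(** For such vectors the compression can be dropped, see [omega_class]. *)
Definition supported X := forall k, N (ell2_col X k).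

Lemma supported_compress X : supported (tensl_fun P X).
Proof.
move=> k; have -> : ell2_col (tensl_fun P X) k = P (ell2_col X k) by exact: ell2_ext.
exact: (P_range P_proj).
Qed.

Lemma compress_supported X : supported X -> tensl_fun P X = X.
Proof.
move=> XN; apply: ell2_ext => -[i k].
by rewrite -[LHS]/(P (ell2_col X k) i) (P_id P_proj (XN k)).
Qed.

Lemma omega_class X Y w : supported X -> supported Y -> omega X Y (g w) = omega X Y (Lop R w).
Proof. by move=> XN YN; rewrite omega_compress !compress_supported. Qed.

Lemma predual_supported phi : exists X Y, [/\ supported X, supported Y & phi = omegaM M X Y].
Proof.
have [X [Y phiE]] := predual_omega M_sub (set_valP phi).
exists (tensl_fun P X), (tensl_fun P Y); split; try exact: supported_compress.
apply/val_inj/(predual_ext (set_valP phi)); first exact: (set_valP (omegaM M _ _)).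
move=> w; rewrite phiE.
rewrite -[RHS]/(omega (tensl_fun P X) (tensl_fun P Y) (g w)).
by rewrite omega_class; [exact: omega_compress|exact: supported_compress..].
Qed.

(** Evaluation at the group-like elements g_w gives one direction. For the other,
    chi and (phi (x) psi) o DeltaJ are weak-star continuous and agree at the g_w. *)
Lemma is_convolutionP phi psi chi : is_convolution DeltaJ phi psi chi <->
  forall w, \val chi (piL P w) = \val phi (piL P w) * \val psi (piL P w).
Proof.
have [Dcont Dlin _ Dpi] := DeltaJ_comul; split.
  by move=> [theta th chiE] w; rewrite chiE Dpi th.
move=> chiE; have [X [Y phiE]] := predual_omega M_sub (set_valP phi).
have [X' [Y' psiE]] := predual_omega M_sub (set_valP psi).
pose theta := omegaM (wtensor M M) (tens X X') (tens Y Y').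
have thE : is_tensor_functional phi psi theta.
  by move=> A B; rewrite phiE psiE -omega_tens.
exists theta => //; apply/funeqP.
apply: predual_ext (set_valP chi) _ _; last by move=> w; rewrite chiE -thE Dpi.
have [thl thc] := set_valP theta; split.
  by move=> a A B C CE; apply: thl; exact: Dlin CE.
move=> A; exact: (@continuous_comp (wstar_on M) (wstar_on (wtensor M M)) R[i]^o
  DeltaJ (\val theta) A (Dcont A) (thc (DeltaJ A))).
Qed.

(** The indicator function of the class of w is square summable since the class
    is finite, all its words having the same length. It is a class function,
    hence in N, and the functional pairs it with the vacuum vector. *)
Lemma class_functional w : g w != 0 ->
  exists delta : predual M, forall v, \val delta (piL P v) = (g v == g w)%:R.
Proof.
move=> gw; pose e : H := fvec (size w) (fun v => (g v == g w)%:R).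
have J1 : ~ J 1.
  move=> J1; move/eqP: gw; apply; apply/(class_zeroP J_ideal J_hom P_proj).
  by rewrite -[Lop R w]mulr1; apply: idealMl => //; exact: Lop_Lalg.
have eE v : e v = (g v == g w)%:R.
  rewrite fvecE; case: ifPn => //; case: eqP => // vw.
  by rewrite (class_size J_ideal J_hom P_proj vw) ?vw// leqnn.
have Ne : N e.
  apply: (class_function_Nperp J_ideal J_hom P_proj DeltaJ_comul).
  split=> [u v uv|u u0]; first by rewrite !eE uv.
  by rewrite eE u0 eq_sym (negbTE gw).
exists (omegaM M (single (xi R [::])) (single e)) => v.
rewrite -[LHS]/(omega (single (xi R [::])) (single e) (g v)) omega_single.
rewrite /compress !bopME (P_adj P_proj) (P_id P_proj Ne).
rewrite (P_id P_proj (vacuum_Nperp J_ideal J_hom J1)) Lop_xi cats0.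
by rewrite inner_conj inner_xi eE rmorph_nat.
Qed.

(** Right translation by a word is compatible with the classes ([class_mulr]), so the
    columns of star X Y are class functions. *)
Lemma star_supported X Y : supported X -> supported Y -> supported (star X Y).
Proof.
move=> XN YN m; apply: (class_function_Nperp J_ideal J_hom P_proj DeltaJ_comul).
have cl Z k : supported Z -> class_function P (ell2_col Z k).
  by move=> ZN; apply: (Nperp_class_function J_ideal J_hom P_proj).
case: (star_col X Y m) => [->|[a [b [k [l E]]]]]; first by split.
have [Xeq X0] := cl X k XN; have [Yeq Y0] := cl Y l YN.
split=> [u v uv|u u0]; rewrite !E.
  congr (_ * _); [apply: (Xeq (u ++ a) (v ++ a))|apply: (Yeq (u ++ b) (v ++ b))];
  exact: (class_mulr J_ideal J_hom P_proj).
rewrite (_ : X _ = 0) ?mul0r//; apply: (X0 (u ++ a)).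
exact: (class_mulr0 J_ideal J_hom P_proj).
Qed.

Lemma omega_Lop_bound X Y w : (sqnorm X <= (4^-1)%:E)%E -> (sqnorm Y <= (4^-1)%:E)%E ->
  normc (omega X Y (Lop R w)) <= 2^-1.
Proof.
move=> X4 Y4; have -> : 2^-1 = 4^-1 + 4^-1 :> R by field.
apply: inner_le => //; apply: le_trans (sqnorm_tensl X ler01 _) _.
  by move=> x; rewrite mul1e /= sqnorm_shift.
by rewrite mul1e.
Qed.

(** The glued powers of X and Y under star represent the sum of the convolution
    powers of omega X Y. The bound 1/4 on the squared norms makes the value at
    each g_w at most 1/2, and the glued sequences square summable. *)
Lemma quasi_inverse X Y : supported X -> supported Y ->
  (sqnorm X <= (4^-1)%:E)%E -> (sqnorm Y <= (4^-1)%:E)%E ->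
  exists psi : predual M, forall w, \val psi (piL P w) =
    omega X Y (g w) + omega X Y (g w) * \val psi (piL P w).
Proof.
move=> XN YN X4 Y4.
pose pow (Z : D) n := iter n (star Z) Z.
have pow_supp (Z : D) n : supported Z -> supported (pow Z n).
  by move=> ZN; elim: n => // n IHn; exact: star_supported.
have pow_le (Z : D) n : (sqnorm Z <= (4^-1)%:E)%E -> (sqnorm (pow Z n) <= (2^-1 ^+ n.+1)%:E)%E.
  move=> Z4; have Z2 : (sqnorm Z <= (2^-1)%:E)%E.
    by apply: le_trans Z4 _; rewrite lee_fin lef_pV2 ?posrE// ler_nat.
  elim: n => // n IHn; rewrite /= sqnorm_star exprS EFinM.
  by apply: lee_pmul => //; exact: sqnorm_ge0.
have pow_fin (Z : D) : (sqnorm Z <= (4^-1)%:E)%E ->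
    (\esum_(n in [set: nat]) sqnorm (pow Z n) < +oo)%E.
  move=> Z4; apply: le_lt_trans (ltry 1); apply: le_trans (half_powers_esum R).
  by apply: le_esum => n _; exact: pow_le.
have pow_omega n w : omega (pow X n) (pow Y n) (Lop R w) = omega X Y (Lop R w) ^+ n.+1.
  by elim: n => // n IHn; rewrite omega_star IHn -exprS.
have glue_supp (Z : D) (Z4 : (sqnorm Z <= (4^-1)%:E)%E) :
    supported Z -> supported (glue (pow_fin Z Z4)).
  move=> ZN m; case: (glue_col_eq (pow_fin Z Z4) m) => [->|[k [n ->]]].
    by move=> A JA; rewrite inner0r.
  exact: pow_supp.
exists (omegaM M (glue (pow_fin X X4)) (glue (pow_fin Y Y4))) => w.
rewrite -[\val _ _]/(omega (glue (pow_fin X X4)) (glue (pow_fin Y Y4)) (g w)).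
rewrite !omega_class //; try exact: glue_supp.
rewrite omega_glue; under eq_fun do rewrite pow_omega.
exact/geometric_quasi_inverse/omega_Lop_bound.
Qed.

Lemma predual_comb (a : R[i]) phi psi : exists chi : predual M,
  \val chi = a *: \val phi + \val psi.
Proof.
have [X [Y ->]] := predualP M_sub phi; have [X' [Y' ->]] := predualP M_sub psi.
have [Z [V ZV]] := omegaD (a *: X) Y X' Y'.
by exists (omegaM M Z V); apply/funext => A; rewrite /= ZV omegaZl.
Qed.

Lemma piL_eq u v : g u = g v -> piL P u = piL P v.
Proof. by move=> uv; apply: val_inj. Qed.

Section OneCharacter.
Variable rho : predual M -> R[i]^o.
Hypothesis rho_lin : linear_on rho.
Hypothesis rho_mul : forall phi psi chi,
  is_convolution DeltaJ phi psi chi -> rho chi = rho phi * rho psi.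

Lemma character_comb a phi psi chi :
  \val chi = a *: \val phi + \val psi -> rho chi = a * rho phi + rho psi.
Proof. exact: rho_lin. Qed.

Lemma predual0 : exists2 z : predual M, \val z = 0 & rho z = 0.
Proof.
pose z := omegaM M 0 0; have z0 : \val z = 0.
  by apply/funext => A; rewrite /= /omega inner0r.
by exists z => //; exact: (linear_on0 rho_lin).
Qed.

(** Apply rho to phi * delta = phi(g_w) delta and cancel rho(delta). *)
Lemma character_evaluation w (delta : predual M) :
  (forall v, \val delta (piL P v) = (g v == g w)%:R) -> rho delta != 0 ->
  rho = evaluation (piL P w).
Proof.
move=> deltaE rd; apply/funext => phi; rewrite /evaluation.
have [z z0 rz] := predual0.
have [chi chiE] := predual_comb (\val phi (piL P w)) delta z.
have := @rho_mul phi delta chi; rewrite (character_comb chiE) rz addr0 => H.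
apply: (mulIf rd); rewrite -H //; apply/is_convolutionP => v.
rewrite chiE z0 addr0 -[LHS]/(_ * \val delta (piL P v)) deltaE.
by case: eqP => [/piL_eq ->|_]; rewrite ?mulr0.
Qed.

Section Vanishing.
Hypothesis rho0 : forall w (delta : predual M),
  (forall v, \val delta (piL P v) = (g v == g w)%:R) -> g w != 0 -> rho delta = 0.

(** The values of psi on the classes of l are subtracted one after the other. *)
Lemma character_finite (l : seq W) psi :
  (forall v, (forall w, w \in l -> g v != g w) -> \val psi (piL P v) = 0) -> rho psi = 0.
Proof.
elim: l psi => [|w l IHl] psi psi0.
  apply: (linear_on0 rho_lin); apply: predual_ext (set_valP psi) _ _.
    by have [z z0 _] := predual0; rewrite -z0; exact: (set_valP z).
  by move=> v; rewrite psi0.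
have [gw|gw] := eqVneq (g w) 0.
  apply: IHl => v vl; have [vw|vw] := eqVneq (g v) (g w).
    by have [psil _] := set_valP psi; apply: (linear_on0 psil); rewrite -gw -vw.
  by apply: psi0 => u; rewrite inE => /orP[/eqP ->//|]; exact: vl.
have [delta deltaE] := class_functional gw.
have [chi chiE] := predual_comb (- \val psi (piL P w)) delta psi.
have := character_comb chiE; rewrite (rho0 deltaE gw) mulr0 add0r => <-.
apply: IHl => v vl; rewrite chiE -[LHS]/(_ * \val delta (piL P v) + \val psi (piL P v)) deltaE.
have [/piL_eq ->|vw] := eqVneq (g v) (g w); first by rewrite mulr1 addNr.
by rewrite mulr0 add0r psi0// => u; rewrite inE => /orP[/eqP ->//|]; exact: vl.
Qed.

Let high p Y : D := mask (fun i : W * nat => (p <= size i.1)%N) Y.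

Lemma supported_high p Y : supported Y -> supported (high p Y).
Proof.
move=> YN k; apply: (class_function_Nperp J_ideal J_hom P_proj DeltaJ_comul).
have [Yeq Y0] := Nperp_class_function J_ideal J_hom P_proj (YN k).
have E u : ell2_col (high p Y) k u = if (p <= size u)%N then ell2_col Y k u else 0 by [].
split=> [u v uv|u u0]; rewrite !E; last by rewrite Y0// if_same.
have [u0|u0] := eqVneq (g u) 0; first by rewrite !Y0 ?if_same// -uv.
by rewrite (Yeq _ _ uv) (class_size J_ideal J_hom P_proj uv u0).
Qed.

(** The difference is given by the part of Y in degree less than p, so that it
    vanishes at all words of length at least p. *)
Lemma character_high p X Y : supported X -> supported Y ->
  rho (omegaM M X (high p Y)) = rho (omegaM M X Y).
Proof.
move=> XN YN; have YhN := supported_high p YN.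
have YlN : supported (Y - high p Y).
  move=> k; rewrite -[_ - _]addrC -scaleN1r ell2_colD ell2_colZ.
  exact: Nperp_linear.
have low0 : rho (omegaM M X (Y - high p Y)) = 0.
  apply: (@character_finite [seq (t : W) | t : p.-bseq 'I_d]) => v vl.
  rewrite -[LHS]/(omega X (Y - high p Y) (g v)) omega_class// /omega innerE.
  have pv : (p <= size v)%N.
    rewrite leqNgt; apply/negP => vp; have := vl v; rewrite eqxx => /(_ _)/negP; case=> //.
    by apply/mapP; exists (Bseq (ltnW vp)); rewrite ?mem_enum.
  apply: csumE; apply: has_sum0 => -[u k].
  rewrite ell2BE maskE /=; case: ifPn => pu; first by rewrite subrr rmorph0 mulr0.
  rewrite /= /shift_fun; case: prefixP => [[u' uE]|_]; last by rewrite mul0r.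
  by case/negP: pu; rewrite uE size_cat (leq_trans pv)// leq_addr.
have := @character_comb 1 (omegaM M X (Y - high p Y)) (omegaM M X (high p Y)) (omegaM M X Y).
rewrite low0 mulr0 add0r => -> //.
apply/funext => A; rewrite scale1r.
rewrite -[RHS]/(omega X (Y - high p Y) (\val A) + omega X (high p Y) (\val A)) omegaBr.
by rewrite subrK.
Qed.

Lemma character_zero phi : rho phi = 0.
Proof.
apply/eqP/negPn/negP => c0; have [X [Y [XN YN phiE]]] := predual_supported phi.
set c := rho phi in c0.
have Xf : sqnorm X \is a fin_num by rewrite ge0_fin_numE ?ell2_fin ?sqnorm_ge0.
pose al := fine (sqnorm X); have al0 : 0 <= al by rewrite fine_ge0 ?sqnorm_ge0.
(* t^2 al <= 1/4, and b is such that t times the conjugate of b is 1/c. *)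
pose t := (2 * (al + 1))^-1; have t0 : 0 < t by rewrite invr_gt0 mulr_gt0// ltr_wpDl.
pose b : R[i] := ((c * t%:C)^-1)^*.
have tC0 : t%:C != 0 :> R[i] by rewrite eq_complex /= eqxx andbT gt_eqF.
have b0 : 0 < 4 * (abs2 b + 1) by rewrite mulr_gt0// ltr_wpDl// abs2_ge0.
have e0 : 0 < (4 * (abs2 b + 1))^-1 by rewrite invr_gt0.
have [p pY] := sqnorm_tail Y (fun i : W * nat => size i.1) e0.
pose X1 := t%:C *: X; pose Y1 := b *: high p Y.
have scaled (Z : D) a : supported Z -> supported (a *: Z).
  move=> ZN k; rewrite ell2_colZ -[_ *: _]addr0; apply: Nperp_linear => //.
  by move=> A _; rewrite inner0r.
have X1N : supported X1 by exact: scaled.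
have Y1N : supported Y1 by exact/scaled/supported_high.
have X14 : (sqnorm X1 <= (4^-1)%:E)%E.
  rewrite /X1 sqnormZ abs2_real -(fineK Xf) -EFinM lee_fin -/al /t exprVn.
  rewrite mulrC ler_pdivrMr ?exprn_gt0 ?mulr_gt0 ?ltr_wpDl//.
  rewrite exprMn mulrA (_ : 4^-1 * 2 ^+ 2 = 1); last by field.
  by rewrite mul1r sqrrD1 -addrA ler_wpDl ?sqr_ge0// mulr2n -addrA lerDl addr_ge0.
have Y14 : (sqnorm Y1 <= (4^-1)%:E)%E.
  rewrite /Y1 sqnormZ; apply: le_trans (lee_wpmul2l _ pY) _.
    by rewrite lee_fin abs2_ge0.
  rewrite -EFinM lee_fin ler_pdivrMr// mulrA mulVf// mul1r lerDl.
  exact: ler01.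
pose phi1 := omegaM M X1 Y1.
have rphi1 : rho phi1 = 1.
  have [z z0 rz] := predual0.
  have := @character_comb c^-1 (omegaM M X (high p Y)) z phi1.
  rewrite rz addr0 character_high// -phiE -/c mulVf// => -> //.
  rewrite z0 addr0; apply/funext => A.
  rewrite -[LHS]/(omega X1 Y1 (\val A)) -[RHS]/(c^-1 * omega X (high p Y) (\val A)).
  by rewrite omegaZl omegaZr conjCK invfM mulrA mulrCA divff// mulr1.
have [psi psiE] := quasi_inverse X1N Y1N X14 Y14.
have [chi chiE] := predual_comb (-1) phi1 psi.
have := @rho_mul phi1 psi chi; rewrite (character_comb chiE) rphi1 mul1r mulr1 => H.
have /eqP : -1 + rho psi = rho psi.
  apply: H; apply/is_convolutionP => w.
  rewrite chiE -[LHS]/(-1 * omega X1 Y1 (g w) + \val psi (piL P w)) [in LHS]psiE.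
  by rewrite mulN1r addrA addNr add0r.
by rewrite -subr_eq0 addrK oppr_eq0 oner_eq0.
Qed.

End Vanishing.

Lemma character_is_evaluation phi : rho phi != 0 ->
  exists2 w, g w != 0 & rho = evaluation (piL P w).
Proof.
move=> rphi; apply: contrapT => noev; move/eqP: rphi; apply.
apply: character_zero => w delta deltaE gw; apply/eqP/negPn/negP => rd.
by apply: noev; exists w => //; exact: character_evaluation rd.
Qed.

End OneCharacter.

Lemma evaluation_spectrum w : g w != 0 -> spectrum DeltaJ (evaluation (piL P w)).
Proof.
move=> gw; have [delta deltaE] := class_functional gw; split.
- by move=> a phi psi chi; rewrite /evaluation => ->.
- by move=> phi psi chi /is_convolutionP; apply.
- by exists delta; rewrite /evaluation deltaE eqxx oner_eq0.
Qed.

Lemma evaluation_inj u v : evaluation (piL P u) = evaluation (piL P v) -> g u = g v.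
Proof.
move=> uv; apply: bop_ext => x; apply: ell2_ext => i; rewrite -!inner_xi -!omega_single.
exact: (congr1 (fun f => f (omegaM M (single x) (single (xi R i)))) uv).
Qed.

End Characters.

Section WordClasses.
Variables (R : realType) (d : nat) (J : set (bop R (word d))).
Hypothesis J_ideal : wot_ideal J.
Implicit Types u v w : word0 d.

Lemma wequivxx u : wequiv J u u.
Proof. by rewrite /wequiv subrr; exact: ideal0. Qed.

Lemma wequiv_sym u v : wequiv J u v -> wequiv J v u.
Proof.
move=> uv; rewrite /wequiv -[X in J X]addr0 -opprB -scaleN1r.
by apply: idealP => //; exact: ideal0.
Qed.

Lemma wequiv_trans u v w : wequiv J u v -> wequiv J v w -> wequiv J u w.
Proof.
move=> uv vw; rewrite /wequiv.
have -> : Lop0 R u - Lop0 R w = 1 *: (Lop0 R u - Lop0 R v) + (Lop0 R v - Lop0 R w).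
  by rewrite scale1r addrA subrK.
exact: idealP.
Qed.

Lemma wclass_eq u v : wequiv J u v -> wclass J u = wclass J v.
Proof.
move=> uv; apply/seteqP; split=> w; first exact/wequiv_trans/wequiv_sym.
exact: wequiv_trans.
Qed.

End WordClasses.

Theorem theorem5p4 (R : realType) (d : nat) (d_gt0 : (0 < d)%N)
  (Delta : Lalg R d -> wtensor (Lalg R d) (Lalg R d))
  (Delta_comul : comultiplication (Lelt R d) Delta)
  (Delta_cc : completely_contractive Delta)
  (J : set (bop R (word d)))
  (J_hopf : hopf_ideal Delta J) (J_homogeneous : homogeneous_ideal J)
  (P : bop R (word d)) (P_proj : is_orth_proj (Nperp J) P)
  (DeltaJ : Lquot P -> wtensor (Lquot P) (Lquot P))
  (DeltaJ_comul : comultiplication (piL P) DeltaJ) :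
  exists rho : set (word0 d) -> predual (Lquot P) -> R[i]%C,
    set_bij (nonzero_classes J) (spectrum DeltaJ) rho /\
    (forall (s : set (word0 d)) (w : word d),
       nonzero_classes J s -> s (Some w) -> rho s = evaluation (piL P w)).
Proof.
have [J_ideal _] := J_hopf.
have class_eq u v : wequiv J (Some u) (Some v) <->
    compress P (Lop R u) = compress P (Lop R v).
  exact: iff_sym (class_eqP J_ideal J_homogeneous P_proj u v).
have class_0 u : wequiv J (Some u) None <-> compress P (Lop R u) = 0.
  by rewrite /wequiv subr0; exact: iff_sym (class_zeroP J_ideal J_homogeneous P_proj u).
have nonzero_repr s : nonzero_classes J s ->
    exists2 w, s = wclass J (Some w) & compress P (Lop R w) != 0.
  move=> [[[w|] _ <-] sN]; last by case: sN.
  exists w => //; apply/eqP => /class_0 w0; apply: sN; exact: wclass_eq.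
have nonzero_class w : compress P (Lop R w) != 0 -> nonzero_classes J (wclass J (Some w)).
  move=> /eqP w0; split; first by exists (Some w).
  move=> wN; apply/w0/class_0/(wequiv_sym J_ideal).
  have : wclass J (Some w) (Some w) by exact: wequivxx.
  by rewrite wN.
pose rho (s : set (word0 d)) : predual (Lquot P) -> R[i]%C :=
  if pselect (exists w, s (Some w)) is left sw then evaluation (piL P (projT1 (cid sw)))
  else fun=> 0.
have rhoE s w : nonzero_classes J s -> s (Some w) -> rho s = evaluation (piL P w).
  move=> /nonzero_repr[u -> _] uw; rewrite /rho.
  case: pselect => [e|[]]; last by exists w.
  case: (cid e) => v /= uv; congr evaluation; apply: piL_eq.
  by rewrite -(proj1 (class_eq u v) uv) -(proj1 (class_eq u w) uw).
exists rho; split => //; split.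
- move=> s sS; have [w sE w0] := nonzero_repr s sS.
  rewrite (rhoE s w) //; last by rewrite sE; exact: wequivxx.
  exact: (evaluation_spectrum J_ideal J_homogeneous P_proj DeltaJ_comul).
- move=> s t /set_mem sS /set_mem tS.
  have [u sE u0] := nonzero_repr s sS; have [v tE v0] := nonzero_repr t tS.
  rewrite (rhoE s u) ?(rhoE t v) //; [|by rewrite ?sE ?tE; exact: wequivxx..].
  by move=> /evaluation_inj /class_eq uv; rewrite sE tE; exact: wclass_eq.
- move=> chi [chi_lin chi_mul [phi chi_phi]].
  have [w w0 ->] := character_is_evaluation J_ideal J_homogeneous P_proj DeltaJ_comul
    chi_lin chi_mul chi_phi.
  exists (wclass J (Some w)); first exact: nonzero_class.
  by apply: rhoE; [exact: nonzero_class|exact: wequivxx].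
Qed.
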